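(* Let $G$ be an acyclic mixed graph with mixed components $G_1,\dots,G_k$. Then: (i) $G$ is rationally identifiable if and only if every $G_j$ is rationally identifiable, and $G$ is generically identifiable if and only if every $G_j$ is generically identifiable; (ii) $\phi_G$ is generically infinite-to-one if and only if $\phi_{G_j}$ is generically infinite-to-one for some $j$; (iii) if each $G_j$ is generically $h_j$-to-one with $h_j<\infty$, then $G$ is generically $h$-to-one with $h=\prod_{j=1}^k h_j$.
   Context: A mixed graph is $G=(V,D,B)$ with $V$ a finite node set (here $V=[m]$), $D$ directed edges $v\to w$, $B$ symmetric bidirected edges $v\leftrightarrow w$, no self-loops; acyclic if $(V,D)$ has no directed cycle. $\mathrm{pa}(v)=\{w:w\to v\in D\}$. For a mixed graph on node set $V$: $\mathbb{R}^D_{\mathrm{reg}}$ is the set of real $V\times V$ matrices $\Lambda$ with $\lambda_{vw}=0$ for $v\to w\notin D$ and $I-\Lambda$ invertible; $\mathrm{PD}(B)$ the positive definite symmetric $\Omega$ with $\omega_{vw}=0$ for $v\ne w$, $v\leftrightarrow w\notin B$; $\Theta=\mathbb{R}^D_{\mathrm{reg}}\times\mathrm{PD}(B)$; $\phi_G(\Lambda,\Omega)=(I-\Lambda)^{-T}\Omega(I-\Lambda)^{-1}$. A proper algebraic subset of $\Theta$ is the zero set in $\Theta$ of polynomials in the entries, not all of $\Theta$. $G$ is rationally identifiable if there exist a proper algebraic subset $W$ and a rational map $\psi$ with $\psi\circ\phi_G=\mathrm{id}$ on $\Theta\setminus W$; generically identifiable if $\phi_G$ is injective on $\Theta\setminus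 W$ for some proper algebraic subset $W$; $\phi_G$ is generically infinite-to-one if the fibers $\{(\Lambda',\Omega')\in\Theta:\phi_G(\Lambda',\Omega')=\phi_G(\Lambda,\Omega)\}$ are infinite outside a proper algebraic subset. $G$ is generically $h$-to-one ($h\in\mathbb{N}\cup\{\infty\}$) if the complex extension of $\phi_G$, defined on pairs $(\Lambda,\Omega)$ of complex matrices with the same support constraints, $I-\Lambda$ invertible and $\Omega$ symmetric, has fibers of cardinality $h$ outside a proper algebraic subset. Mixed components: let $C_1,\dots,C_k$ be the node sets of the connected components of the bidirected graph $(V,B)$. For $j\in[k]$ let $V_j=C_j\cup\bigcup_{v\in C_j}\mathrm{pa}(v)$, $D_j=\{v\to w\in D: v\in V_j, w\in C_j\}$, $B_j=B\cap(C_j\times C_j)$, and $G_j=(V_j,D_j,B_j)$. *)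

(* Defs.v *)
From HB Require Import structures.
From mathcomp Require Import all_boot all_order all_algebra all_field.
Set Implicit Arguments. Unset Strict Implicit. Unset Printing Implicit Defensive.
Import Order.TTheory GRing.Theory Num.Theory.
Local Open Scope ring_scope.

(* dir v w  <->  v -> w in D ;  bid v w  <->  v <-> w in B *)
Record mgraph (V : finType) := MGraph { dir : rel V; bid : rel V }.

Definition mixed_graph (V : finType) (G : mgraph V) : Prop :=
  irreflexive (dir G) /\ irreflexive (bid G) /\ symmetric (bid G).

Definition acyclic (V : finType) (G : mgraph V) : Prop :=
  forall (v : V) (p : seq V), path (dir G) v p -> last v p = v -> p = [::].

Definition pa (V : finType) (G : mgraph V) (v : V) : {set V} :=
  [set w | dir G w v].

Definition comps (V : finType) (G : mgraph V) : {set {set V}} :=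
  [set [set w | connect (bid G) v w] | v : V].

Definition comp_nodes (V : finType) (G : mgraph V) (C : {set V}) : {set V} :=
  C :|: \bigcup_(v in C) pa G v.

Definition comp_type (V : finType) (G : mgraph V) (C : {set V}) : finType :=
  {x : V | x \in comp_nodes G C}.

Definition comp_graph (V : finType) (G : mgraph V) (C : {set V}) :
  mgraph (comp_type G C) :=
  MGraph (fun x y : comp_type G C => dir G (val x) (val y) && (val y \in C))
         (fun x y : comp_type G C =>
            [&& bid G (val x) (val y), val x \in C & val y \in C]).

Definition mat (V : finType) (R : Type) := {ffun V * V -> R}.

Definition tomx (V : finType) (R : Type) (A : mat V R) : 'M[R]_#|V| :=
  \matrix_(i, j) A (enum_val i, enum_val j).
Definition frommx (V : finType) (R : Type) (M : 'M[R]_#|V|) : mat V R :=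
  [ffun p => M (enum_rank p.1) (enum_rank p.2)].

Definition idm (V : finType) (R : pzRingType) : mat V R :=
  [ffun p => (p.1 == p.2)%:R].

(* parameter pairs (Lambda, Omega) *)
Definition param (V : finType) (R : Type) := (mat V R * mat V R)%type.

Definition phi (V : finType) (R : comUnitRingType) (th : param V R) : mat V R :=
  let M := invmx (tomx (idm V R - th.1)) in
  frommx (M^T *m tomx th.2 *m M).

Definition supp_ok (V : finType) (R : comUnitRingType) (G : mgraph V)
    (th : param V R) : Prop :=
  (forall v w : V, ~~ dir G v w -> th.1 (v, w) = 0) /\
  (forall v w : V, v != w -> ~~ bid G v w -> th.2 (v, w) = 0) /\
  (forall v w : V, th.2 (v, w) = th.2 (w, v)) /\
  tomx (idm V R - th.1) \in unitmx.

Definition posdef (V : finType) (R : numFieldType) (O : mat V R) : Prop :=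
  forall x : 'cV[R]_#|V|, x != 0 -> 0 < (x^T *m tomx O *m x) 0 0.

Definition ThetaR (V : finType) (R : numFieldType) (G : mgraph V)
    (th : param V R) : Prop :=
  supp_ok G th /\ posdef th.2.

Definition ThetaC (V : finType) (C : comUnitRingType) (G : mgraph V)
    (th : param V C) : Prop := supp_ok G th.

Inductive is_poly (I : Type) (R : pzRingType) : ((I -> R) -> R) -> Prop :=
| Poly_const (c : R) : is_poly (fun _ => c)
| Poly_var (i : I) : is_poly (fun x => x i)
| Poly_add p q : is_poly p -> is_poly q -> is_poly (fun x => p x + q x)
| Poly_mul p q : is_poly p -> is_poly q -> is_poly (fun x => p x * q x).

Definition coords (V : finType) (R : Type) (th : param V R) : (V * V + V * V) -> R :=
  fun i => match i with inl p => th.1 p | inr p => th.2 p end.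

Definition proper_alg (V : finType) (R : pzRingType) (Th : param V R -> Prop)
    (W : param V R -> Prop) : Prop :=
  (exists S : ((V * V + V * V -> R) -> R) -> Prop,
     (forall p, S p -> is_poly p) /\
     (forall th, W th <-> (Th th /\ forall p, S p -> p (coords th) = 0))) /\
  (exists th, Th th /\ ~ W th).

Definition rat_ident (V : finType) (R : rcfType) (G : mgraph V) : Prop :=
  exists W : param V R -> Prop, proper_alg (ThetaR G) W /\
  exists num den : (V * V + V * V) -> ((V * V -> R) -> R),
    (forall i, is_poly (num i) /\ is_poly (den i)) /\
    forall th, ThetaR G th -> ~ W th ->
      forall i, den i (phi th) != 0 /\
                num i (phi th) / den i (phi th) = coords th i.

Definition gen_ident (V : finType) (R : rcfType) (G : mgraph V) : Prop :=
  exists W : param V R -> Prop, proper_alg (ThetaR G) W /\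
  forall th th', ThetaR G th -> ~ W th -> ThetaR G th' -> ~ W th' ->
    phi th = phi th' -> th = th'.

Definition infinite_pred (T : eqType) (P : T -> Prop) : Prop :=
  forall s : seq T, exists x, P x /\ x \notin s.

Definition gen_inf (V : finType) (R : rcfType) (G : mgraph V) : Prop :=
  exists W : param V R -> Prop, proper_alg (ThetaR G) W /\
  forall th, ThetaR G th -> ~ W th ->
    infinite_pred (fun th' => ThetaR G th' /\ phi th' = phi th).

Definition gen_h_to_one (V : finType) (C : numClosedFieldType) (G : mgraph V)
    (h : nat) : Prop :=
  exists W : param V C -> Prop, proper_alg (ThetaC G) W /\
  forall th, ThetaC G th -> ~ W th ->
    exists s : seq (param V C), [/\ uniq s, size s = h &
      forall th', (ThetaC G th' /\ phi th' = phi th) <-> th' \in s].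

(* Main.v *)
Require Import Defs.
From HB Require Import structures.
From mathcomp Require Import all_boot all_order all_algebra all_field.
From mathcomp Require Import ring.
From Stdlib Require Import Classical.
Set Implicit Arguments. Unset Strict Implicit. Unset Printing Implicit Defensive.
Import Order.TTheory GRing.Theory Num.Theory.
Local Open Scope ring_scope.

(* Order the nodes so that edges increase the rank. A nondegenerate Sigma has a
   unique unitriangular E with E^T Sigma E diagonal, and E is rational in Sigma.
   If Sigma = phi (Lambda, Omega) and N is the factor of Omega, uniqueness gives
   E = (I - Lambda) N. As N is block diagonal along the mixed components, the
   columns of E and the diagonal entries indexed by C only involve the parameters
   of G_C, and they determine Sigma. Hence Sigma determines, and is determined
   by, the matrices phi_{G_C}, rationally in both directions, and the fibre of
   phi_G is the product of the fibres of the phi_{G_C}. To transfer genericity,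
   parameters of G_C are plugged into a fixed point of Theta_G and conversely;
   proper algebraic subsets are reduced to nonvanishing of one polynomial, and
   products stay nonvanishing because Theta is convex. *)

(** * LDL factors and the fibres of phi *)

(** A parent of [C] outside [C] becomes a source of $G_C$ with a variance of its own, to which no
    parameter of $G$ corresponds. So $\Theta_G$ is not literally a product of the $\Theta_{G_C}$:
    passing from $G$ to $G_C$ needs a base point that supplies these variances, and passing back
    forgets them. They do no harm: such a node is isolated in the bidirected graph of $G_C$, its row
    and column in the factor [N] are trivial, and its variance can be read off from the image of
    [phi].

    The LDL data of a matrix, written as a parameter pair, ignore the edges of the graph but depend
    on the matrix alone. Exchanging columns between such pairs gives a pair congruent to the one
    obtained by exchanging the original parameters, hence with the same image; this turns statements
    about parameters into statements about covariance matrices.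

    Positive definiteness makes every real point nondegenerate. A complex symmetric [Omega] may be
    degenerate, so there nondegeneracy is one more generic condition. *)

Section MatrixEntries.
Context (T : finType) (F : comUnitRingType).
Implicit Types A B : mat T F.

Definition matmul A B : mat T F := [ffun p => \sum_u A (p.1, u) * B (u, p.2)].
Definition mattr A : mat T F := [ffun p => A (p.2, p.1)].

Lemma sum_enum_val (f : T -> F) : \sum_(i < #|T|) f (enum_val i) = \sum_u f u.
Proof. by rewrite [RHS](reindex (@enum_val T predT)) //; apply/onW_bij/enum_val_bij. Qed.

Lemma tomxK : cancel (@tomx T F) (@frommx T F).
Proof. by move=> A; apply/ffunP=> -[u v]; rewrite ffunE mxE !enum_rankK. Qed.

Lemma frommxK : cancel (@frommx T F) (@tomx T F).
Proof. by move=> A; apply/matrixP=> i j; rewrite mxE ffunE !enum_valK. Qed.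

Lemma tomx_mul A B : tomx (matmul A B) = tomx A *m tomx B.
Proof.
apply/matrixP=> i j; rewrite !mxE ffunE /= -sum_enum_val.
by apply: eq_bigr => k _; rewrite !mxE.
Qed.

Lemma tomx_tr A : tomx (mattr A) = (tomx A)^T.
Proof. by apply/matrixP=> i j; rewrite !mxE ffunE. Qed.

Lemma matmulA A B C : matmul A (matmul B C) = matmul (matmul A B) C.
Proof. by apply: (can_inj tomxK); rewrite !tomx_mul mulmxA. Qed.

Lemma mattr_mul A B : mattr (matmul A B) = matmul (mattr B) (mattr A).
Proof. by apply: (can_inj tomxK); rewrite !(tomx_tr, tomx_mul) trmx_mul. Qed.

(* (L, O) and congr_param N (L, O) have the same image under phi: congruence
   parametrises the fibres of phi. *)
Definition congr_param N (th : param T F) : param T F :=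
  (idm T F - matmul (idm T F - th.1) N, matmul (mattr N) (matmul th.2 N)).

Lemma idm_sub_congr N th :
  idm T F - (congr_param N th).1 = matmul (idm T F - th.1) N.
Proof. by rewrite /= opprB addrCA subrr addr0. Qed.

Lemma phi_congr N th : tomx N \in unitmx ->
  tomx (idm T F - th.1) \in unitmx -> phi (congr_param N th) = phi th.
Proof.
move=> uN uL; rewrite /phi idm_sub_congr !tomx_mul tomx_tr.
set L := tomx _; have uLN : L *m tomx N \in unitmx by rewrite unitmx_mul uL.
have -> : invmx (L *m tomx N) = invmx (tomx N) *m invmx L.
  apply: (can_inj (mulKmx uLN)).
  by rewrite /= mulmxV // -mulmxA (mulmxA (tomx N)) mulmxV // mul1mx mulmxV.
rewrite trmx_mul -!mulmxA; congr (frommx (_ *m _)).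
rewrite (mulmxA (tomx N) (invmx _)) mulmxV // mul1mx.
rewrite (mulmxA _ (tomx N)^T) -trmx_mul mulmxV // trmx1 mul1mx.
by rewrite ?mulmxA.
Qed.

Lemma phi_eq th : tomx (idm T F - th.1) \in unitmx ->
  matmul (mattr (idm T F - th.1)) (matmul (phi th) (idm T F - th.1)) = th.2.
Proof.
move=> uL; apply: (can_inj tomxK); rewrite !tomx_mul tomx_tr frommxK.
set L := tomx _; rewrite -!mulmxA mulVmx // mulmx1 !mulmxA -trmx_mul.
by rewrite mulVmx // trmx1 mul1mx.
Qed.

End MatrixEntries.

Section Triangular.
Context (T : finType) (F : fieldType) (rk : T -> nat).
Implicit Types A S O N : mat T F.

(** Nodes of equal rank count as incomparable: inside a rank level [A] is the identity. A
    non-injective rank, such as the number of ancestors, is therefore allowed. *)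
Definition unitri A :=
  forall u v, (rk v <= rk u)%N -> A (u, v) = (u == v)%:R.

(** Forward substitution: coordinate [u] of the row vector [y A] is [y u] plus terms of strictly
    smaller rank. *)
Lemma unitri_low_solve A k (y : T -> F) : unitri A ->
  (forall u, (rk u < k)%N -> \sum_v y v * A (v, u) = 0) ->
  forall u, (rk u < k)%N -> y u = 0.
Proof.
move=> uA Ay u; have [n] := ubnP (rk u); elim: n u => // n IHn u lt_un lt_uk.
have := Ay u lt_uk; rewrite (bigD1 u) //= uA // eqxx mulr1 big1 ?addr0 //.
move=> v nvu; have [le_uv|lt_vu] := leqP (rk u) (rk v).
  by rewrite uA // (negbTE nvu) mulr0.
by rewrite IHn ?mul0r //; [apply: leq_trans lt_vu _ | apply: ltn_trans lt_uk].
Qed.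

(** Back substitution from the largest rank downwards, hence the induction on [K - rk u] with [K]
    above all ranks. *)
Lemma unitri_up_solve A k (x : T -> F) : unitri A ->
  (forall u, (k <= rk u)%N -> \sum_v A (u, v) * x v = 0) ->
  forall u, (k <= rk u)%N -> x u = 0.
Proof.
move=> uA Ax u; pose K := (\max_v rk v).+1.
have ltK v : (rk v < K)%N by rewrite ltnS leq_bigmax.
have [n] := ubnP (K - rk u)%N; elim: n u => // n IHn u lt_un le_ku.
have := Ax u le_ku; rewrite (bigD1 u) //= uA // eqxx mul1r big1 ?addr0 //.
move=> v nvu; have [le_vu|lt_uv] := leqP (rk v) (rk u).
  by rewrite uA // eq_sym (negbTE nvu) mul0r.
rewrite IHn ?mulr0 //; last by apply: leq_trans le_ku (ltnW _).
by rewrite -ltnS; apply: leq_trans lt_un; rewrite ltnS ltn_sub2l.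
Qed.

Lemma unitmx_ker0 n (M : 'M[F]_n) :
  (forall x : 'cV_n, M *m x = 0 -> x = 0) -> M \in unitmx.
Proof.
move=> ker0; rewrite -unitmx_tr -row_free_unit -kermx_eq0.
apply/eqP/row_matrixP=> i; rewrite row0; apply: trmx_inj; rewrite trmx0.
by apply: ker0; rewrite -{1}[M]trmxK -trmx_mul -row_mul mulmx_ker row0 trmx0.
Qed.

Lemma unitri_unit A : unitri A -> tomx A \in unitmx.
Proof.
move=> uA; apply: unitmx_ker0 => x Ax0.
have x0 u : x (enum_rank u) 0 = 0.
  apply: (unitri_up_solve (k := 0%N) (x := fun v => x (enum_rank v) 0) uA) => // {}u _.
  have /matrixP/(_ (enum_rank u) 0) := Ax0; rewrite !mxE => Axu.
  rewrite -[RHS]Axu -[LHS]sum_enum_val; apply: eq_bigr => i _.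
  by rewrite mxE enum_rankK enum_valK.
by apply/matrixP=> i j; rewrite ord1 mxE -(enum_valK i) x0.
Qed.

(* All the leading principal minors of S are nonzero, phrased as kernels. *)
Definition nondeg S := forall k (e : T -> F),
  (forall u, (k <= rk u)%N -> e u = 0) ->
  (forall u, (rk u < k)%N -> \sum_v S (u, v) * e v = 0) ->
  forall u, e u = 0.

(** The block of ranks below [k], padded with an identity so that all thresholds share one matrix
    size and the determinant is still the leading minor. *)
Definition lead_mx k S : 'M[F]_#|T| := \matrix_(i, j)
  if (rk (enum_val i) < k)%N && (rk (enum_val j) < k)%N
  then S (enum_val i, enum_val j) else (i == j)%:R.

Lemma lead_mx_mul k S (x : 'cV_#|T|) u :
  (lead_mx k S *m x) (enum_rank u) 0 =
  if (rk u < k)%N then \sum_(v | (rk v < k)%N) S (u, v) * x (enum_rank v) 0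
  else x (enum_rank u) 0.
Proof.
rewrite mxE; case: ifP => lt_uk.
  rewrite [RHS]big_mkcond /= -[RHS]sum_enum_val; apply: eq_bigr => i _.
  rewrite mxE enum_rankK lt_uk /= enum_valK; case: ifP => // ge_ik.
  case: eqP => [eui|]; last by rewrite mul0r.
  by rewrite -eui enum_rankK lt_uk in ge_ik.
rewrite (bigD1 (enum_rank u)) //= mxE enum_rankK lt_uk eqxx mul1r.
by rewrite big1 ?addr0 // => j nju; rewrite mxE enum_rankK lt_uk eq_sym (negbTE nju) mul0r.
Qed.

(** The kernel form suits the triangular arguments; the invertible form gives the explicit inverse
    behind rationality and the polynomial condition behind genericity. *)
Lemma nondeg_lead_mx S : nondeg S <-> (forall k, lead_mx k S \in unitmx).
Proof.
split=> [ndS k | uS k e e_hi Se0].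
  apply: unitmx_ker0 => x Sx0.
  have Sxu u : (lead_mx k S *m x) (enum_rank u) 0 = 0 by rewrite Sx0 mxE.
  have x0 : forall u, x (enum_rank u) 0 = 0.
    apply: (ndS k) => u lt_uk; have := Sxu u; rewrite lead_mx_mul.
      by rewrite ltnNge lt_uk.
    rewrite lt_uk => Su; rewrite (bigID (fun v => (rk v < k)%N)) /= Su add0r.
    rewrite big1 // => v ge_vk; have := Sxu v; rewrite lead_mx_mul.
    by rewrite (negbTE ge_vk) => ->; rewrite mulr0.
  by apply/matrixP=> i j; rewrite ord1 mxE -(enum_valK i) x0.
pose x : 'cV_#|T| := \col_i e (enum_val i).
have x0 : x = 0.
  rewrite -[x]mul1mx -(mulVmx (uS k)) -mulmxA; set y := lead_mx k S *m x.
  suff -> : y = 0 by rewrite mulmx0.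
  apply/matrixP=> i j; rewrite ord1 -(enum_valK i) lead_mx_mul [RHS]mxE.
  case: ifP => lt_ik; last by rewrite mxE enum_rankK e_hi // leqNgt lt_ik.
  rewrite -[RHS](Se0 _ lt_ik) [RHS](bigID (fun v => (rk v < k)%N)) /= [X in _ + X]big1 ?addr0.
    by apply: eq_bigr => v _; rewrite mxE enum_rankK.
  by move=> v ge_vk; rewrite e_hi ?mulr0 // leqNgt.
by move=> u; have /matrixP/(_ (enum_rank u) 0) := x0; rewrite !mxE enum_rankK.
Qed.

(** Past the largest rank the threshold changes nothing, so nondegeneracy is a condition on finitely
    many minors. *)
Lemma lead_mx_large k S :
  lead_mx (minn k (\max_u rk u).+1) S = lead_mx k S.
Proof.
have rk_lt u : (rk u < (\max_u rk u).+1)%N by rewrite ltnS leq_bigmax.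
by apply/matrixP=> i j; rewrite !mxE !leq_min !rk_lt !andbT.
Qed.

(* Column w of the unitriangular E such that E^T S E is diagonal. *)
Definition is_ldl_col S w (e : T -> F) :=
  (forall u, (rk w <= rk u)%N -> e u = (u == w)%:R) /\
  (forall u, (rk u < rk w)%N -> \sum_v S (u, v) * e v = 0).

(** The column solves a linear system: the identity rows impose [e u = (u == w)] at ranks at least
    [rk w], and in the other rows the known entry [e w = 1] has been moved to the right-hand
    side. *)
Definition ldl_col S w : 'cV[F]_#|T| := invmx (lead_mx (rk w) S) *m
  \col_i (if (rk (enum_val i) < rk w)%N then - S (enum_val i, w)
          else (enum_val i == w)%:R).

Definition ldl_factor S : mat T F :=
  [ffun p => ldl_col S p.2 (enum_rank p.1) 0].

(** The difference of two solutions lives at ranks below [rk w] and is killed by the corresponding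
    block of [S], which is the situation excluded by [nondeg]. *)
Lemma ldl_col_uniq S w e e' : nondeg S ->
  is_ldl_col S w e -> is_ldl_col S w e' -> e =1 e'.
Proof.
move=> ndS [e_hi Se] [e'_hi Se'] u; apply/eqP; rewrite -subr_eq0; apply/eqP.
apply: (ndS (rk w) (fun v => e v - e' v)) => {}u rk_u.
  by rewrite e_hi // e'_hi // subrr.
under eq_bigr do rewrite mulrBr.
by rewrite sumrB Se // Se' // subrr.
Qed.

Lemma ldl_factorP S w : nondeg S -> is_ldl_col S w (fun u => ldl_factor S (u, w)).
Proof.
move=> /nondeg_lead_mx ndS; set e := fun u => _.
have Se u := lead_mx_mul (rk w) S (ldl_col S w) u.
have {}Se u : (if (rk u < rk w)%N then - S (u, w) else (u == w)%:R) =
    if (rk u < rk w)%N then \sum_(v | (rk v < rk w)%N) S (u, v) * e v else e u.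
  have := Se u; rewrite {1}/ldl_col mulmxA mulmxV // mul1mx mxE enum_rankK => ->.
  by rewrite /e ffunE /=; case: ifP => // _; apply: eq_bigr => v _; rewrite /e ffunE.
have e_hi u : (rk w <= rk u)%N -> e u = (u == w)%:R.
  by move=> le_wu; have := Se u; rewrite ltnNge le_wu /= => <-.
split=> // u lt_uw; rewrite (bigID (fun v => (rk v < rk w)%N)) /=.
have := Se u; rewrite lt_uw => <-; rewrite (bigD1 w) ?ltnn //= e_hi // eqxx mulr1.
rewrite big1 ?addr0 ?addNr // => v /andP[ge_vw nvw].
by rewrite e_hi ?(negbTE nvw) ?mulr0 // leqNgt.
Qed.

Lemma ldl_factor_unitri S : nondeg S -> unitri (ldl_factor S).
Proof. by move=> ndS u v le_vu; have [->] := ldl_factorP v ndS. Qed.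

Lemma unitri_mul_hi A (e : T -> F) k u : unitri A -> (k <= rk u)%N ->
  (forall v, (k <= rk v)%N -> v != u -> A (u, v) * e v = 0) ->
  \sum_v A (u, v) * e v = e u.
Proof.
move=> uA le_ku e0; rewrite (bigD1 u) //= uA // eqxx mul1r big1 ?addr0 // => v nvu.
have [le_kv|lt_vk] := leqP k (rk v); first exact: e0.
by rewrite uA ?(leq_trans (ltnW lt_vk)) // eq_sym (negbTE nvu) mul0r.
Qed.

Lemma sum_matmul A B (x : T -> F) u :
  \sum_v matmul A B (u, v) * x v = \sum_v A (u, v) * \sum_w B (v, w) * x w.
Proof.
under eq_bigr do rewrite ffunE /= mulr_suml.
rewrite exchange_big; apply: eq_bigr => v _.
by rewrite mulr_sumr; apply: eq_bigr => w _; rewrite mulrA.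
Qed.

Section Phi.
Variable th : param T F.
Let L := idm T F - th.1.
Hypothesis uL : unitri L.

Lemma phi_apply (x : T -> F) u :
  \sum_v L (v, u) * (\sum_w phi th (v, w) * (\sum_t L (w, t) * x t)) =
  \sum_v th.2 (u, v) * x v.
Proof.
rewrite -(phi_eq (unitri_unit uL)) -/L sum_matmul; apply: eq_bigr => v _.
by congr (_ * _); [rewrite [RHS]ffunE | rewrite sum_matmul].
Qed.

(* y |-> L^T y is lower unitriangular *)
Lemma phi_apply_low (x : T -> F) k :
  (forall u, (rk u < k)%N -> \sum_v th.2 (u, v) * x v = 0) ->
  forall u, (rk u < k)%N -> \sum_w phi th (u, w) * (\sum_t L (w, t) * x t) = 0.
Proof.
move=> Ox; apply: (unitri_low_solve uL) => u lt_uk.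
by rewrite -[RHS](Ox u lt_uk) -phi_apply; apply: eq_bigr => v _; rewrite mulrC.
Qed.

Lemma unitri_apply_hi A (x : T -> F) k : unitri A ->
  (forall u, (k <= rk u)%N -> x u = 0) ->
  forall u, (k <= rk u)%N -> \sum_v A (u, v) * x v = 0.
Proof.
move=> uA x_hi u le_ku; rewrite big1 // => v _.
have [le_kv|lt_vk] := leqP k (rk v); first by rewrite x_hi ?mulr0.
rewrite uA ?(leq_trans (ltnW lt_vk)) //; case: eqP => [euv|]; last by rewrite mul0r.
by rewrite -euv ltnNge le_ku in lt_vk.
Qed.

(** Both [L] and its inverse preserve the spaces of vectors supported at ranks below [k], and the
    transpose of [L] acts triangularly on the first [k] levels of equations, so kernel vectors for
    [phi th] and [th.2] correspond through [L]. *)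
Lemma nondeg_phi : nondeg (phi th) <-> nondeg th.2.
Proof.
split=> nd k e e_hi e0.
  move=> u; apply: (unitri_up_solve (k := 0%N) (x := e) uL) => // {}u _; move: u.
  by apply: (nd k); [apply: unitri_apply_hi | apply: phi_apply_low].
pose x u := (invmx (tomx L) *m \col_i e (enum_val i)) (enum_rank u) 0.
have Lx u : \sum_v L (u, v) * x v = e u.
  pose z := tomx L *m (invmx (tomx L) *m \col_i e (enum_val i)).
  have -> : \sum_v L (u, v) * x v = z (enum_rank u) 0.
    rewrite mxE -[LHS]sum_enum_val; apply: eq_bigr => i _.
    by rewrite mxE enum_rankK /x enum_valK.
  by rewrite /z mulmxA mulmxV ?unitri_unit // mul1mx mxE enum_rankK.
have x_hi u : (k <= rk u)%N -> x u = 0.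
  by move: u; apply: (unitri_up_solve uL) => u le_ku; rewrite Lx e_hi.
have x0 : forall u, x u = 0.
  apply: (nd k) => // u lt_uk; rewrite -phi_apply big1 // => v _.
  under eq_bigr do rewrite Lx.
  have [lt_vk|le_kv] := ltnP (rk v) k; first by rewrite e0 ?mulr0.
  rewrite uL ?(leq_trans (ltnW lt_uk)) //; case: eqP => [evu|]; last by rewrite mul0r.
  by rewrite evu leqNgt lt_uk in le_kv.
by move=> u; rewrite -Lx big1 // => v _; rewrite x0 mulr0.
Qed.

Lemma ldl_factor_phi : nondeg th.2 -> ldl_factor (phi th) = matmul L (ldl_factor th.2).
Proof.
move=> ndO; apply/ffunP=> -[u w]; rewrite [RHS]ffunE /=.
have nds : nondeg (phi th) by apply/nondeg_phi.
apply: (ldl_col_uniq (e' := fun u => \sum_t L (u, t) * ldl_factor th.2 (t, w))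
  nds (ldl_factorP w nds)).
have [n_hi On] := ldl_factorP w ndO; split; last exact: phi_apply_low.
move=> {}u le_wu; rewrite (unitri_mul_hi uL (leqnn _)) ?n_hi // => v le_uv nvu.
rewrite n_hi ?(leq_trans le_wu) //; case: eqP => [evw|]; last by rewrite mulr0.
by rewrite uL 1?eq_sym ?(negbTE nvu) ?mul0r // evw.
Qed.

(** The pair $(I - E, E^T S E)$, where [E] is the LDL factor of [S]: a point over [S] computed from
    [S] alone, with no regard for the edges of a graph. *)
Definition ldl_param S : param T F := congr_param (ldl_factor S) (0, S).

(** The canonical point over [phi th] differs from [th] by a congruence that depends only on [th.2],
    and so inherits its block structure. *)
Lemma ldl_param_phi : nondeg th.2 ->
  ldl_param (phi th) = congr_param (ldl_factor th.2) th.
Proof.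
move=> ndO; rewrite /ldl_param /congr_param subr0 ldl_factor_phi // -/L.
have m1 A : matmul (idm T F) A = A.
  apply/ffunP=> -[u v]; rewrite ffunE (bigD1 u) //= ffunE eqxx mul1r big1 ?addr0 //.
  by move=> t ntu; rewrite ffunE /= eq_sym (negbTE ntu) mul0r.
rewrite m1; congr (_, _).
rewrite mattr_mul /=; set N := ldl_factor _.
by rewrite -[th.2](phi_eq (unitri_unit uL)) -/L !matmulA.
Qed.

End Phi.

Definition block_closed (C : {set T}) S :=
  forall u v, (u \in C) != (v \in C) -> S (u, v) = 0.

(** Cutting column [w] down to the side of [C] on which [w] lies leaves the defining equations
    valid, so by uniqueness nothing was cut. *)
Lemma ldl_factor_block C S : nondeg S -> block_closed C S ->
  block_closed C (ldl_factor S).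
Proof.
move=> ndS blS u w; set e := fun u => ldl_factor S (u, w).
pose e' u := if (u \in C) == (w \in C) then e u else 0.
have [e_hi Se] := ldl_factorP w ndS.
have e'P : is_ldl_col S w e'.
  split=> [v le_wv | v lt_vw]; rewrite /e'.
    by rewrite /e e_hi //; case: (v =P w) => [->|]; rewrite ?eqxx ?if_same.
  have [evw|nvw] := boolP ((v \in C) == (w \in C)).
    rewrite -[RHS](Se v lt_vw); apply: eq_bigr => t _; case: ifP => // ntw.
    by rewrite blS ?mul0r // (eqP evw) eq_sym ntw.
  rewrite big1 // => t _; case: ifP => [etw|]; last by rewrite mulr0.
  by rewrite blS ?mul0r // (eqP etw).
move=> nuw; rewrite (ldl_col_uniq ndS (ldl_factorP w ndS) e'P).
by rewrite /e' (negbTE nuw).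
Qed.

(** Row and column [v] of the factor [N] of [th.2] are those of the identity, so the congruence does
    not touch the entry at [v]. This recovers the variances of the parents outside a component. *)
Lemma ldl_param_singleton (th : param T F) v : unitri (idm T F - th.1) -> nondeg th.2 ->
  block_closed [set v] th.2 -> (ldl_param (phi th)).2 (v, v) = th.2 (v, v).
Proof.
move=> uL ndO blv; rewrite ldl_param_phi //= ffunE (bigD1 v) //= ffunE /=.
have blN := ldl_factor_block ndO blv.
have N1 : ldl_factor th.2 (v, v) = 1 by rewrite ldl_factor_unitri // eqxx.
rewrite N1 mul1r [X in X + _]ffunE (bigD1 v) //= N1 mulr1 !big1 ?addr0 // => u nuv.
  by rewrite ffunE /= blN ?mul0r // !inE eqxx (negbTE nuv).
by rewrite blN ?mulr0 // !inE eqxx (negbTE nuv).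
Qed.

End Triangular.

(** * Rational functions and generic properties *)

(** The map [c] names the arguments of the quotient: [coords] when genericity is pulled back along a
    map, [phi] when parameters are to be recovered from the image. *)
Definition rational_on (F : fieldType) (X I : Type) (c : X -> I -> F)
    (P : X -> Prop) (f : X -> F) : Prop :=
  exists n d, [/\ is_poly n, is_poly d &
    forall x, P x -> d (c x) != 0 /\ n (c x) / d (c x) = f x].

Section Rational.
Context (F : fieldType) (X I : Type) (c : X -> I -> F) (P : X -> Prop).
Implicit Types f g : X -> F.
Local Notation rat := (rational_on c P).

Lemma rational_ext f g : (forall x, P x -> f x = g x) -> rat f -> rat g.
Proof.
move=> efg [n [d [pn pd nd]]]; exists n, d; split=> // x Px.
by rewrite -efg //; apply: nd.
Qed.

Lemma rational_const a : rat (fun=> a).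
Proof.
exists (fun=> a), (fun=> 1); split=> [||x _]; try exact: Poly_const.
by rewrite oner_eq0 divr1.
Qed.

Lemma rational_coord i : rat (fun x => c x i).
Proof.
exists (fun y => y i), (fun=> 1); split=> [||x _].
- exact: Poly_var.
- exact: Poly_const.
- by rewrite oner_eq0 divr1.
Qed.

Lemma rational_add f g : rat f -> rat g -> rat (fun x => f x + g x).
Proof.
move=> [n [d [pn pd nd]]] [n' [d' [pn' pd' nd']]].
exists (fun y => n y * d' y + n' y * d y), (fun y => d y * d' y).
split=> [||x Px].
- by apply: Poly_add; apply: Poly_mul.
- exact: Poly_mul.
have [d0 <-] := nd x Px; have [d'0 <-] := nd' x Px.
by rewrite mulf_neq0 // addf_div.
Qed.

Lemma rational_mul f g : rat f -> rat g -> rat (fun x => f x * g x).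
Proof.
move=> [n [d [pn pd nd]]] [n' [d' [pn' pd' nd']]].
exists (fun y => n y * n' y), (fun y => d y * d' y).
split=> [||x Px]; try exact: Poly_mul.
have [d0 <-] := nd x Px; have [d'0 <-] := nd' x Px.
by rewrite mulf_neq0 // mulf_div.
Qed.

Lemma rational_opp f : rat f -> rat (fun x => - f x).
Proof.
move=> rf; apply: rational_ext (rational_mul (rational_const (-1)) rf) => x _.
by rewrite mulN1r.
Qed.

Lemma rational_inv f : (forall x, P x -> f x != 0) -> rat f -> rat (fun x => (f x)^-1).
Proof.
move=> f0 [n [d [pn pd nd]]]; exists d, n; split=> // x Px.
have [d0 enf] := nd x Px; split; last by rewrite -enf invf_div.
by apply: contra_neq (f0 x Px) => n0; rewrite -enf n0 mul0r.
Qed.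

Lemma rational_sum J (s : seq J) (Q : pred J) (f : J -> X -> F) :
  (forall j, Q j -> rat (f j)) -> rat (fun x => \sum_(j <- s | Q j) f j x).
Proof.
move=> rf; elim: s => [|j s IHs].
  by apply: rational_ext (rational_const 0) => x _; rewrite big_nil.
have [Qj|nQj] := boolP (Q j); last first.
  by apply: rational_ext IHs => x _; rewrite big_cons (negbTE nQj).
by apply: rational_ext (rational_add (rf j Qj) IHs) => x _; rewrite big_cons Qj.
Qed.

Lemma rational_prod J (s : seq J) (Q : pred J) (f : J -> X -> F) :
  (forall j, Q j -> rat (f j)) -> rat (fun x => \prod_(j <- s | Q j) f j x).
Proof.
move=> rf; elim: s => [|j s IHs].
  by apply: rational_ext (rational_const 1) => x _; rewrite big_nil.
have [Qj|nQj] := boolP (Q j); last first.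
  by apply: rational_ext IHs => x _; rewrite big_cons (negbTE nQj).
by apply: rational_ext (rational_mul (rf j Qj) IHs) => x _; rewrite big_cons Qj.
Qed.

Lemma rational_poly J (p : (J -> F) -> F) (h : X -> J -> F) : is_poly p ->
  (forall j, rat (fun x => h x j)) -> rat (fun x => p (h x)).
Proof.
move=> + rh; elim=> [a|j|q r _ IHq _ IHr|q r _ IHq _ IHr].
- exact: rational_const.
- exact: rh.
- exact: rational_add.
- exact: rational_mul.
Qed.

Lemma rational_comp Y J (c' : Y -> J -> F) (Q : Y -> Prop) (h : X -> Y) (f : Y -> F) :
  (forall j, rat (fun x => c' (h x) j)) -> (forall x, P x -> Q (h x)) ->
  rational_on c' Q f -> rat (fun x => f (h x)).
Proof.
move=> rh PQ [n [d [pn pd nd]]].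
apply: rational_ext (rational_mul (rational_poly pn rh)
  (rational_inv _ (rational_poly pd rh))) => x Px.
  by have [] := nd (h x) (PQ x Px).
by have [] := nd (h x) (PQ x Px).
Qed.

Lemma rational_det n (A : X -> 'M[F]_n) :
  (forall i j, rat (fun x => A x i j)) -> rat (fun x => \det (A x)).
Proof.
move=> rA; apply: rational_sum => s _; apply: rational_mul; first exact: rational_const.
by apply: rational_prod => i _.
Qed.

Lemma rational_mulmx m n p (A : X -> 'M[F]_(m, n)) (B : X -> 'M[F]_(n, p)) :
  (forall i j, rat (fun x => A x i j)) -> (forall i j, rat (fun x => B x i j)) ->
  forall i j, rat (fun x => (A x *m B x) i j).
Proof.
move=> rA rB i j; pose f x := \sum_k A x i k * B x k j.
apply: (@rational_ext f) => [x _|]; first by rewrite mxE.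
by apply: rational_sum => k _; apply: rational_mul.
Qed.

Lemma rational_invmx n (A : X -> 'M[F]_n) : (forall x, P x -> A x \in unitmx) ->
  (forall i j, rat (fun x => A x i j)) -> forall i j, rat (fun x => invmx (A x) i j).
Proof.
move=> uA rA i j.
pose f x := (\det (A x))^-1 * ((-1) ^+ (j + i) * \det (row' j (col' i (A x)))).
apply: (@rational_ext f) => [x Px|].
  by rewrite /invmx uA // !mxE.
apply: rational_mul.
  by apply: rational_inv (rational_det rA) => x /uA; rewrite unitmxE unitfE.
apply: rational_mul; first exact: rational_const.
apply: rational_det => k l; apply: rational_ext (rA (lift j k) (lift i l)) => x _.
by rewrite !mxE.
Qed.

Section Params.
Context (T : finType).

Lemma rational_phi (th : X -> param T F) :
  (forall x, P x -> tomx (idm T F - (th x).1) \in unitmx) ->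
  (forall i, rat (fun x => coords (th x) i)) ->
  forall p, rat (fun x => phi (th x) p).
Proof.
move=> uL rth p; pose M x := invmx (tomx (idm T F - (th x).1)).
have rM i j : rat (fun x => M x i j).
  apply: rational_invmx => // {}i {}j.
  pose q := (enum_val i, enum_val j).
  apply: (@rational_ext (fun x => idm T F q - coords (th x) (inl q))) => [x _|].
    by rewrite !mxE !ffunE.
  by apply: rational_add; [apply: rational_const | apply/rational_opp/rth].
apply: (@rational_ext (fun x =>
    ((M x)^T *m tomx (th x).2 *m M x) (enum_rank p.1) (enum_rank p.2))) => [x _|].
  by rewrite /phi ffunE.
apply: rational_mulmx => //; apply: rational_mulmx => i j.
  by apply: rational_ext (rM j i) => x _; rewrite mxE.
by apply: rational_ext (rth (inr (enum_val i, enum_val j))) => x _; rewrite mxE.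
Qed.

Lemma rational_ldl_param (rk : T -> nat) (S : X -> mat T F) :
  (forall x, P x -> nondeg rk (S x)) -> (forall p, rat (fun x => S x p)) ->
  forall i, rat (fun x => coords (ldl_param rk (S x)) i).
Proof.
move=> ndS rS.
have rE p : rat (fun x => ldl_factor rk (S x) p).
  apply: (@rational_ext (fun x => ldl_col rk (S x) p.2 (enum_rank p.1) 0)) => [x _|].
    by rewrite ffunE.
  apply: rational_mulmx => i j.
    apply: rational_invmx => [x Px|{}i {}j].
      by have /nondeg_lead_mx := ndS x Px.
    case lt_ij: ((rk (enum_val i) < rk p.2)%N && (rk (enum_val j) < rk p.2)%N).
      by apply: rational_ext (rS _) => x _; rewrite mxE lt_ij.
    by apply: rational_ext (rational_const (i == j)%:R) => x _; rewrite mxE lt_ij.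
  case lt_i: (rk (enum_val i) < rk p.2)%N.
    by apply: rational_ext (rational_opp (rS _)) => x _; rewrite mxE lt_i.
  by apply: rational_ext (rational_const (enum_val i == p.2)%:R) => x _; rewrite mxE lt_i.
have rmul (A B : X -> mat T F) : (forall p, rat (fun x => A x p)) ->
    (forall p, rat (fun x => B x p)) -> forall p, rat (fun x => matmul (A x) (B x) p).
  move=> rA rB p; apply: (@rational_ext (fun x => \sum_u A x (p.1, u) * B x (u, p.2))).
    by move=> x _; rewrite ffunE.
  by apply: rational_sum => u _; apply: rational_mul.
case=> p /=.
  pose f x := idm T F p - matmul (idm T F - 0) (ldl_factor rk (S x)) p.
  apply: (@rational_ext f) => [x _|]; first by rewrite /f !ffunE.
  apply: rational_add; first exact: rational_const.
  by apply/rational_opp/rmul => // q; apply: rational_const.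
apply: (rmul) => [q|]; last exact: rmul.
by apply: rational_ext (rE (q.2, q.1)) => x _; rewrite [RHS]ffunE.
Qed.

End Params.
End Rational.

Lemma is_poly_ext (I : Type) (F : pzRingType) (p : (I -> F) -> F) (a b : I -> F) :
  is_poly p -> a =1 b -> p a = p b.
Proof.
by move=> + eab; elim=> [x|i|q r _ eq _ er|q r _ eq _ er] //=; rewrite eq er.
Qed.

Lemma is_poly_line (I : Type) (F : comNzRingType) (p : (I -> F) -> F) (a b : I -> F) :
  is_poly p -> exists P : {poly F}, forall t, P.[t] = p (fun i => (1 - t) * a i + t * b i).
Proof.
elim=> [x|i|q r _ [Q eQ] _ [R eR]|q r _ [Q eQ] _ [R eR]].
- by exists x%:P => t; rewrite hornerC.
- exists ((1 - 'X) * (a i)%:P + 'X * (b i)%:P) => t.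
  by rewrite !(hornerE, hornerM, hornerD, hornerN, hornerC, hornerX).
- by exists (Q + R) => t; rewrite hornerD eQ eR.
- by exists (Q * R) => t; rewrite hornerM eQ eR.
Qed.

Definition convex_comb (T : finType) (F : pzRingType) (t : F) (th th' : param T F) :
    param T F :=
  ([ffun p => (1 - t) * th.1 p + t * th'.1 p],
   [ffun p => (1 - t) * th.2 p + t * th'.2 p]).

(** The weights are reciprocals of positive integers: infinitely many points of $[0,1]$, available
    in the real and in the complex case alike. *)
Definition segment_closed (T : finType) (F : unitRingType) (Th : param T F -> Prop) :=
  forall th th' k, Th th -> Th th' -> Th (convex_comb k.+1%:R^-1 th th').

Definition poly_on (T : finType) (F : pzRingType) (Th : param T F -> Prop)
    (n : (T * T + T * T -> F) -> F) : Prop :=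
  is_poly n /\ exists th, Th th /\ n (coords th) != 0.

(* Q holds for pairs of points off a proper algebraic subset; a property of a
   single point is the case where Q ignores its second argument. *)
Definition generic (T : finType) (F : pzRingType) (Th : param T F -> Prop)
    (Q : param T F -> param T F -> Prop) : Prop :=
  exists2 n, poly_on Th n & forall th th', Th th -> n (coords th) != 0 ->
    Th th' -> n (coords th') != 0 -> Q th th'.

Section Generic.
Context (T : finType) (F : numFieldType) (Th : param T F -> Prop).
Hypothesis segTh : segment_closed Th.

(** On the segment joining the two witnesses both polynomials become univariate; one is nonzero at
    [t = 0], the other at [t = 1]. Their product is a nonzero univariate polynomial, which cannot
    vanish at all the permitted weights. *)
Lemma poly_onM n n' : poly_on Th n -> poly_on Th n' -> poly_on Th (fun y => n y * n' y).
Proof.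
move=> [pn [th [Tth n0]]] [pn' [th' [Tth' n'0]]].
split; first exact: Poly_mul.
have [p ep] := is_poly_line (coords th) (coords th') pn.
have [q eq] := is_poly_line (coords th) (coords th') pn'.
have pq0 : p * q != 0.
  apply: mulf_neq0; apply/eqP=> z0.
    have := ep 0; rewrite z0 horner0 => ez; move/eqP: n0; apply; rewrite ez.
    by apply: is_poly_ext pn _ => i; rewrite subr0 mul1r mul0r addr0.
  have := eq 1; rewrite z0 horner0 => ez; move/eqP: n'0; apply; rewrite ez.
  by apply: is_poly_ext pn' _ => i; rewrite subrr mul0r mul1r add0r.
(* As many distinct weights as the size of [p * q], which is one more than its degree, so one of
   them is not a root. *)
pose s : seq F := [seq k.+1%:R^-1 | k <- iota 0 (size (p * q))].
have us : uniq s.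
  rewrite map_inj_uniq ?iota_uniq // => k l /invr_inj/eqP.
  by rewrite eqr_nat => /eqP[].
have /allPn[_ /mapP[k _ ->]] : ~~ all (root (p * q)) s.
  apply/negP=> rs; have := max_poly_roots pq0 rs us.
  by rewrite size_map size_iota ltnn.
rewrite rootE hornerM ep eq => npq0.
exists (convex_comb k.+1%:R^-1 th th'); split; first exact: segTh.
apply: contra_neq npq0 => <-; congr (_ * _).
  by apply: is_poly_ext pn _ => -[u|u] /=; rewrite ffunE.
by apply: is_poly_ext pn' _ => -[u|u] /=; rewrite ffunE.
Qed.

Lemma generic_sub (Q Q' : param T F -> param T F -> Prop) :
  (forall th th', Th th -> Th th' -> Q th th' -> Q' th th') ->
  generic Th Q -> generic Th Q'.
Proof. by move=> QQ' [n pn nQ]; exists n => // th th' *; apply/QQ'/nQ. Qed.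

Lemma generic_and Q Q' : generic Th Q -> generic Th Q' ->
  generic Th (fun th th' => Q th th' /\ Q' th th').
Proof.
move=> [n pn nQ] [n' pn' nQ']; exists (fun y => n y * n' y); first exact: poly_onM.
by move=> th th' Tth; rewrite mulf_eq0 => /norP[? ?] Tth'; rewrite mulf_eq0 => /norP[? ?];
   split; [apply: nQ | apply: nQ'].
Qed.

Lemma generic_all (J : eqType) (s : seq J) (Q : J -> param T F -> param T F -> Prop) :
  (exists th, Th th) -> (forall j, j \in s -> generic Th (Q j)) ->
  generic Th (fun th th' => forall j, j \in s -> Q j th th').
Proof.
move=> [th0 Tth0]; elim: s => [_|j s IHs gQ].
  exists (fun=> 1) => //; split; first exact: Poly_const.
  by exists th0; rewrite oner_eq0.
have gs : generic Th (fun th th' => forall j, j \in s -> Q j th th').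
  by apply: IHs => k ks; apply: gQ; rewrite inE ks orbT.
apply: generic_sub (generic_and (gQ j (mem_head j s)) gs) => th th' _ _ [Qj Qs] k.
by rewrite inE => /predU1P[->|/Qs].
Qed.

(** One equation of [W] that fails at a point outside [W] already suffices as the nonvanishing
    condition. *)
Lemma proper_alg_poly W : proper_alg Th W ->
  exists2 n, poly_on Th n & forall th, Th th -> n (coords th) != 0 -> ~ W th.
Proof.
move=> [[S [pS WS]] [th [Tth nW]]].
have [p pS0] : exists p, ~ (S p -> p (coords th) = 0).
  by apply: not_all_ex_not => all0; apply/nW/WS.
have [Sp /eqP p0] := imply_to_and _ _ pS0.
exists p; first by split; [apply: pS | exists th].
by move=> th' _ /eqP p'0 /WS[_ /(_ p Sp)].
Qed.

Lemma poly_proper_alg n : poly_on Th n ->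
  proper_alg Th (fun th => Th th /\ n (coords th) = 0).
Proof.
move=> [pn [th [Tth n0]]]; split; last by exists th; split=> // -[_ /eqP]; apply/negP.
exists (fun p => p = n); split=> [p -> // | th'].
by split=> -[Tth' Hn]; split=> //; [move=> p -> | apply: Hn].
Qed.

Lemma exists_proper_alg (Q : param T F -> param T F -> Prop) :
  (exists W, proper_alg Th W /\
     forall th th', Th th -> ~ W th -> Th th' -> ~ W th' -> Q th th') <->
  generic Th Q.
Proof.
split=> [[W [/proper_alg_poly[n pn nW] WQ]] | [n pn nQ]].
  by exists n => // th th' *; apply: WQ; auto.
exists (fun th => Th th /\ n (coords th) = 0); split; first exact: poly_proper_alg.
move=> th th' Tth Wth Tth' Wth'; apply: nQ => //; apply/eqP=> n0.
  exact: Wth.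
exact: Wth'.
Qed.

(** The numerator serves: the denominator has no zero on [Th]. Conditions pulled back along rational
    maps become polynomial ones this way. *)
Lemma rational_poly_on f : rational_on (@coords T F) Th f ->
  (exists th, Th th /\ f th != 0) ->
  exists2 n, poly_on Th n & forall th, Th th -> (n (coords th) != 0) = (f th != 0).
Proof.
move=> [n [d [pn pd nd]]] [th [Tth fth]].
have nf th' : Th th' -> (n (coords th') != 0) = (f th' != 0).
  by move=> /nd[d0 <-]; rewrite mulf_eq0 invr_eq0 (negbTE d0) orbF.
by exists n => //; split=> //; exists th; rewrite nf.
Qed.

End Generic.

(** * Transporting a mixed component between two graphs *)

Definition ranked (T : finType) (G : mgraph T) (rk : T -> nat) : Prop :=
  forall v w, dir G v w -> (rk v < rk w)%N.

Definition bid_closed (T : finType) (G : mgraph T) (C : {set T}) : Prop :=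
  forall v w, bid G v w -> (v \in C) = (w \in C).

Section Ranked.
Context (T : finType) (F : fieldType) (G : mgraph T) (rk : T -> nat).
Hypothesis rkG : ranked G rk.
Implicit Types th : param T F.

Lemma supp_unitri th : (forall v w, ~~ dir G v w -> th.1 (v, w) = 0) ->
  unitri rk (idm T F - th.1).
Proof.
move=> supp u v le_vu; rewrite !ffunE /= supp ?subr0 //.
by apply: contraL le_vu => /rkG; rewrite ltnNge.
Qed.

(** Acyclicity makes $I - \Lambda$ unitriangular, so its invertibility comes for free and linear
    equations remain; convexity of the parameter space rests on this. *)
Lemma supp_ok_ranked th : supp_ok G th <->
  [/\ forall v w, ~~ dir G v w -> th.1 (v, w) = 0,
      forall v w, v != w -> ~~ bid G v w -> th.2 (v, w) = 0 &
      forall v w, th.2 (v, w) = th.2 (w, v)].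
Proof.
split=> [[? [? [? _]]] // | [sL sO symO]]; split=> //; split=> //; split=> //.
exact/unitri_unit/supp_unitri.
Qed.

Lemma supp_block_closed th C : bid_closed G C -> supp_ok G th -> block_closed C th.2.
Proof.
move=> clC [_ [sO _]] u v nuv; apply: sO.
  by apply: contraNneq nuv => ->.
by apply: contra nuv => /clC ->.
Qed.

Lemma supp_ok_id : supp_ok G (0, idm T F).
Proof.
apply/supp_ok_ranked; split=> v w /=; rewrite ?ffunE //=.
  by move=> /negbTE ->.
by rewrite eq_sym.
Qed.

Lemma supp_ok_segment : segment_closed (@supp_ok T F G).
Proof.
move=> th th' k /supp_ok_ranked[sL sO syO] /supp_ok_ranked[sL' sO' syO'].
apply/supp_ok_ranked; split=> v w /=.
- by move=> nd; rewrite ffunE sL // sL' // !mulr0 addr0.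
- by move=> nvw nb; rewrite ffunE sO // sO' // !mulr0 addr0.
- by rewrite !ffunE /= syO syO'.
Qed.

End Ranked.

Section PositiveDefinite.
Context (T : finType) (F : numFieldType).

Lemma posdefP (O : mat T F) : posdef O <->
  forall x : T -> F, (exists u, x u != 0) -> 0 < \sum_u \sum_v x u * O (u, v) * x v.
Proof.
have formE (y : 'cV[F]_#|T|) : (y^T *m tomx O *m y) 0 0 =
    \sum_u \sum_v y (enum_rank u) 0 * O (u, v) * y (enum_rank v) 0.
  rewrite exchange_big mxE -[RHS]sum_enum_val; apply: eq_bigr => j _.
  rewrite mxE mulr_suml -[RHS]sum_enum_val; apply: eq_bigr => i _.
  by rewrite !mxE !enum_valK.
split=> [pO x [u xu] | pO y y0].
  pose y : 'cV_#|T| := \col_i x (enum_val i).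
  have yE v : y (enum_rank v) 0 = x v by rewrite mxE enum_rankK.
  have y0 : y != 0 by apply: contraNneq xu => y0; rewrite -yE y0 mxE.
  have := pO y y0; rewrite formE; congr (0 < _).
  by apply: eq_bigr => v _; apply: eq_bigr => w _; rewrite !yE.
rewrite formE; apply: (pO (fun u => y (enum_rank u) 0)).
have /existsP[i yi] : [exists i, y i 0 != 0].
  apply: contraNT y0; rewrite negb_exists => /forallP y0; apply/eqP/matrixP=> i j.
  by rewrite ord1 mxE; apply/eqP; have := y0 i; rewrite negbK.
by exists (enum_val i); rewrite enum_valK.
Qed.

(** For a vector [e] as in [nondeg], each index has either [e v = 0] or $(Oe)_v = 0$, so the
    quadratic form vanishes at [e]. *)
Lemma posdef_nondeg rk (O : mat T F) : posdef O -> nondeg rk O.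
Proof.
move=> /posdefP pO k e e_hi Oe u; apply/eqP/negPn/negP=> eu.
have := pO e (ex_intro _ u eu); rewrite big1 ?ltxx // => v _.
under eq_bigr do rewrite -mulrA.
rewrite -mulr_sumr; have [lt_vk|le_kv] := ltnP (rk v) k.
  by rewrite Oe // mulr0.
by rewrite e_hi // mul0r.
Qed.

Lemma ThetaR_segment (G : mgraph T) rk : ranked G rk -> segment_closed (@ThetaR T F G).
Proof.
move=> rkG th th' k [sth /posdefP pO] [sth' /posdefP pO']; split.
  exact: (supp_ok_segment rkG).
apply/posdefP=> x x0; set t : F := _^-1.
have t_gt0 : 0 < t by rewrite invr_gt0 ltr0Sn.
have t_le1 : 0 <= 1 - t by rewrite subr_ge0 invf_le1 ?ltr0Sn // (ler_nat F 1 k.+1).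
suff -> : \sum_u \sum_v x u * (convex_comb t th th').2 (u, v) * x v =
    (1 - t) * (\sum_u \sum_v x u * th.2 (u, v) * x v) +
    t * (\sum_u \sum_v x u * th'.2 (u, v) * x v).
  by rewrite ltr_wpDl ?mulr_gt0 ?pO' // mulr_ge0 // ltW // pO.
rewrite !mulr_sumr -big_split; apply: eq_bigr => u _ /=.
rewrite !mulr_sumr -big_split; apply: eq_bigr => v _ /=.
by rewrite ffunE; ring.
Qed.

End PositiveDefinite.

Lemma ThetaR_id (T : finType) (F : realFieldType) (G : mgraph T) rk :
  ranked G rk -> ThetaR G (0, idm T F).
Proof.
move=> rkG; split; first exact: supp_ok_id rkG.
apply/posdefP=> x [u xu].
have formE v : \sum_w x v * idm T F (v, w) * x w = x v ^+ 2.
  rewrite (bigD1 v) //= ffunE eqxx mulr1 big1 ?addr0 // => w nwv.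
  by rewrite ffunE /= eq_sym (negbTE nwv) mulr0 mul0r.
under eq_bigr do rewrite formE.
rewrite (bigD1 u) //= ltr_pwDl ?exprn_even_gt0 //.
by apply: sumr_ge0 => v _; rewrite sqr_ge0.
Qed.

(* f embeds the part of G2 that matters for the columns of C2 (C2 and its
   parents) into G1, so that C1 and C2 carry the same mixed component. *)
Record overlap (T1 T2 : finType) (G1 : mgraph T1) (G2 : mgraph T2)
    (rk1 : T1 -> nat) (rk2 : T2 -> nat) (C1 : {set T1}) (C2 : {set T2})
    (f : T2 -> option T1) : Prop := Overlap {
  ov_inj : forall u v a, f u = Some a -> f v = Some a -> u = v;
  ov_mem : forall v a, f v = Some a -> (a \in C1) = (v \in C2);
  ov_onto : forall a, a \in C1 -> exists v, f v = Some a;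
  ov_total : forall v, v \in C2 -> exists a, f v = Some a;
  ov_parent : forall v w, w \in C2 -> dir G2 v w -> exists a, f v = Some a;
  ov_dir : forall v w a b, f v = Some a -> f w = Some b -> w \in C2 ->
    dir G1 a b = dir G2 v w;
  ov_bid : forall v w a b, f v = Some a -> f w = Some b -> v \in C2 -> w \in C2 ->
    bid G1 a b = bid G2 v w;
  ov_rank : forall v a, f v = Some a -> rk1 a = rk2 v;
  ov_ranked1 : ranked G1 rk1;
  ov_ranked2 : ranked G2 rk2;
  ov_closed1 : bid_closed G1 C1;
  ov_closed2 : bid_closed G2 C2 }.

Section SpliceDef.
Context (T1 T2 : finType) (F : nmodType) (f : T2 -> option T1) (C2 : {set T2}).

Definition pull_mat (A : mat T1 F) : mat T2 F :=
  [ffun p => if f p.1 is Some a then if f p.2 is Some b then A (a, b) else 0 else 0].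

Definition splice_cols (A1 : mat T1 F) (A2 : mat T2 F) : mat T2 F :=
  [ffun p => if p.2 \in C2 then pull_mat A1 p else A2 p].

Definition splice_block (A1 : mat T1 F) (A2 : mat T2 F) : mat T2 F :=
  [ffun p => if (p.1 \in C2) && (p.2 \in C2) then pull_mat A1 p else A2 p].

(** Column [w] of [Lambda] collects the edges into [w], so whole columns are taken from [th1]; of
    [Omega] only the diagonal block of the component is. *)
Definition splice (th1 : param T1 F) (th2 : param T2 F) : param T2 F :=
  (splice_cols th1.1 th2.1, splice_block th1.2 th2.2).

End SpliceDef.

Lemma splice_splice (T1 T1' T2 : finType) (F : nmodType) (f : T2 -> option T1)
    (f' : T2 -> option T1') (C : {set T2}) (x : param T1 F) (y : param T1' F) b :
  splice f C x (splice f' C y b) = splice f C x b.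
Proof.
by congr pair; apply/ffunP=> p; rewrite !ffunE /=; case: ifP => pC //; rewrite pC.
Qed.

Section Splice.
Context (T1 T2 : finType) (F : fieldType) (G1 : mgraph T1) (G2 : mgraph T2).
Context (rk1 : T1 -> nat) (rk2 : T2 -> nat) (C1 : {set T1}) (C2 : {set T2}).
Context (f : T2 -> option T1).
Hypothesis ov : overlap G1 G2 rk1 rk2 C1 C2 f.
Local Notation spl := (splice f C2).
Local Notation blk := (splice_block f C2).

Lemma pull_matE (A : mat T1 F) v w a b : f v = Some a -> f w = Some b ->
  pull_mat f A (v, w) = A (a, b).
Proof. by move=> fv fw; rewrite ffunE /= fv fw. Qed.

(** Nodes of [T1] missed by [f] lie outside [C1] by [ov_onto] and contribute nothing; nodes of [T2]
    without image get the default 0. *)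
Lemma sum_overlap (h : T1 -> F) : (forall a, a \notin C1 -> h a = 0) ->
  \sum_a h a = \sum_v oapp h 0 (f v).
Proof.
move=> h0; transitivity (\sum_v \sum_(a | f v == Some a) h a); last first.
  apply: eq_bigr => v _; case fv: (f v) => [a|] /=; last by rewrite big_pred0.
  by rewrite (big_pred1 a) // => b; rewrite eq_sym; apply/eqP/eqP=> [[]|->].
rewrite (exchange_big_dep xpredT) //=; apply: eq_bigr => a _.
have [/(ov_onto ov)[v fv]|/h0 ha0] := boolP (a \in C1); last by rewrite big1.
rewrite (big_pred1 v) // => u; apply/eqP/eqP=> [fu|->//].
exact: (ov_inj ov fu fv).
Qed.

(** Column [b] of [B] is supported on [C1], where [f] is onto, so no term of the product is lost in
    the transport. *)
Lemma matmul_pull (A B : mat T1 F) v w a b :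
  f v = Some a -> f w = Some b -> w \in C2 -> block_closed C1 B ->
  matmul A B (a, b) = \sum_u pull_mat f A (v, u) * pull_mat f B (u, w).
Proof.
move=> fv fw wC blB; have bC : b \in C1 by rewrite (ov_mem ov fw).
rewrite ffunE /= sum_overlap => [|c cC]; last first.
  by rewrite blB ?mulr0 // bC (negbTE cC).
apply: eq_bigr => u _; rewrite !ffunE /= fv fw.
by case: (f u) => [c|] //=; rewrite mul0r.
Qed.

Lemma pull_block (B : mat T1 F) u w : block_closed C1 B ->
  u \notin C2 -> w \in C2 -> pull_mat f B (u, w) = 0.
Proof.
move=> blB uC wC; rewrite ffunE /=; case fu: (f u) => [a|] //.
case fw: (f w) => [b|] //; apply: blB.
by rewrite (ov_mem ov fu) (ov_mem ov fw) wC (negbTE uC).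
Qed.

Lemma splice_block_mul (A1 B1 : mat T1 F) (A2 B2 : mat T2 F) :
  block_closed C1 B1 -> block_closed C2 A2 -> block_closed C2 B2 ->
  matmul (blk A1 A2) (blk B1 B2) = blk (matmul A1 B1) (matmul A2 B2).
Proof.
move=> bB1 bA2 bB2; apply/ffunP=> -[v w]; rewrite [LHS]ffunE [RHS]ffunE /=.
have [vC|vC] := boolP (v \in C2); have [wC|wC] := boolP (w \in C2) => /=.
- have [a fv] := ov_total ov vC; have [b fw] := ov_total ov wC.
  rewrite (pull_matE _ fv fw) (matmul_pull _ fv fw) //; apply: eq_bigr => u _.
  rewrite [blk _ _ (v, u)]ffunE [blk _ _ (u, w)]ffunE /= vC wC andbT.
  have [uC|uC] := boolP (u \in C2) => //=; rewrite (pull_block bB1 uC wC) mulr0.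
  by rewrite bB2 ?mulr0 // wC (negbTE uC).
- rewrite [RHS]ffunE; apply: eq_bigr => u _.
  rewrite [blk _ _ (v, u)]ffunE [blk _ _ (u, w)]ffunE /= vC (negbTE wC) andbF.
  by have [uC|//] := boolP (u \in C2); rewrite bB2 ?mulr0 // uC (negbTE wC).
- rewrite [RHS]ffunE; apply: eq_bigr => u _.
  rewrite [blk _ _ (v, u)]ffunE [blk _ _ (u, w)]ffunE /= (negbTE vC) wC andbT.
  by have [uC|//] := boolP (u \in C2); rewrite bA2 ?mul0r // uC (negbTE vC).
- rewrite [RHS]ffunE; apply: eq_bigr => u _.
  by rewrite [blk _ _ (v, u)]ffunE [blk _ _ (u, w)]ffunE /= (negbTE vC) (negbTE wC) andbF.
Qed.

Lemma mattr_splice_block (A1 : mat T1 F) (A2 : mat T2 F) :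
  mattr (blk A1 A2) = blk (mattr A1) (mattr A2).
Proof.
apply/ffunP=> -[v w]; rewrite !ffunE /= andbC; case: ifP => // _.
by case: (f v) => [a|]; case: (f w) => [b|]; rewrite // ffunE.
Qed.

Lemma block_closed_tr (T : finType) (C : {set T}) (A : mat T F) :
  block_closed C A -> block_closed C (mattr A).
Proof. by move=> bA u v nuv; rewrite ffunE bA // eq_sym. Qed.

Lemma block_closed_mul (T : finType) (C : {set T}) (A B : mat T F) :
  block_closed C A -> block_closed C B -> block_closed C (matmul A B).
Proof.
move=> bA bB u v nuv; rewrite ffunE /= big1 // => w _.
have [euw|nuw] := eqVneq (u \in C) (w \in C); last by rewrite bA ?mul0r.
by rewrite bB ?mulr0 // -euw.
Qed.

(** By block closedness, a column of $(I - \Lambda) N$ indexed in a component combines only columns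
    of $I - \Lambda$ from that component. Hence congruence can be done before or after the
    exchange. *)
Lemma splice_congr (N1 : mat T1 F) (N2 : mat T2 F) (th1 : param T1 F) (th2 : param T2 F) :
  block_closed C1 N1 -> block_closed C2 N2 ->
  block_closed C1 th1.2 -> block_closed C2 th2.2 ->
  spl (congr_param N1 th1) (congr_param N2 th2) = congr_param (blk N1 N2) (spl th1 th2).
Proof.
move=> bN1 bN2 bO1 bO2; congr pair; last first.
  rewrite /= mattr_splice_block (splice_block_mul _ bN1 bO2 bN2).
  rewrite (splice_block_mul _ (block_closed_mul bO1 bN1) (block_closed_tr bN2)) //.
  exact: block_closed_mul.
apply/ffunP=> -[v w]; rewrite [LHS]ffunE /=; have [wC|wC] := boolP (w \in C2).
  have [b fw] := ov_total ov wC; case fv: (f v) => [a|].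
    rewrite (pull_matE _ fv fw) [LHS]ffunE [RHS]ffunE; congr (_ + _).
      rewrite !ffunE /=; congr (_%:R); congr nat_of_bool.
      by apply/eqP/eqP=> [eab|evw]; [apply: (ov_inj ov fv); rewrite eab |
        move: fv; rewrite evw fw => -[]].
    rewrite [LHS]ffunE [RHS]ffunE (matmul_pull _ fv fw) // [in RHS]ffunE /=.
    congr (- _); apply: eq_bigr => u _; rewrite [blk _ _ _]ffunE /= wC andbT.
    case: ifP => [uC|/negbT uC]; last first.
      by rewrite (pull_block bN1 uC wC) mulr0 bN2 ?mulr0 // wC (negbTE uC).
    have [c fu] := ov_total ov uC; congr (_ * _).
    rewrite (pull_matE _ fv fu) !ffunE /= uC fv fu; congr (_%:R - _).
    congr nat_of_bool; apply/eqP/eqP=> [eac|evu]; last by move: fv; rewrite evu fu => -[].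
    by apply: (ov_inj ov fv); rewrite eac.
  (* A row without counterpart in [T1] is zero on the columns of [C2] on both sides: the pulled
     entries default to 0 and the identity contributes nothing there. *)
  have nvC : v \notin C2 by apply/negP=> /(ov_total ov)[a]; rewrite fv.
  rewrite [LHS]ffunE /= fv [RHS]ffunE [idm _ _ _]ffunE /=.
  have /negbTE -> : v != w by apply: contraNneq nvC => ->.
  rewrite add0r ffunE [matmul _ _ _]ffunE big1 ?oppr0 // => u _ /=.
  rewrite [blk _ _ _]ffunE /= wC andbT; case: ifP => [uC|/negbT uC]; last first.
    by rewrite bN2 ?mulr0 // wC (negbTE uC).
  rewrite !ffunE /= uC fv.
  by have /negbTE -> : v != u; [apply: contraNneq nvC => -> | rewrite subr0 mul0r].
rewrite [LHS]ffunE [RHS]ffunE; congr (_ + _); rewrite [LHS]ffunE [RHS]ffunE.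
congr (- _); rewrite [LHS]ffunE [RHS]ffunE; apply: eq_bigr => u _ /=.
rewrite [blk _ _ _]ffunE /= (negbTE wC) andbF.
have [uC|uC] := boolP (u \in C2); first by rewrite bN2 ?mulr0 // uC (negbTE wC).
by rewrite !ffunE /= (negbTE uC).
Qed.

Lemma splice_supp_ok (th1 : param T1 F) (th2 : param T2 F) : supp_ok G1 th1 -> supp_ok G2 th2 ->
  supp_ok G2 (spl th1 th2).
Proof.
move=> /(supp_ok_ranked (ov_ranked1 ov))[sL1 sO1 sy1].
move=> /(supp_ok_ranked (ov_ranked2 ov))[sL2 sO2 sy2].
apply/(supp_ok_ranked (ov_ranked2 ov)); split=> v w.
- move=> nd; rewrite ffunE /=; case: ifP => wC; last exact: sL2.
  rewrite ffunE /=; case fv: (f v) => [a|] //; case fw: (f w) => [b|] //.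
  by rewrite sL1 // (ov_dir ov fv fw wC).
- move=> nvw nb; rewrite ffunE /=; case: ifP => [/andP[vC wC]|_]; last exact: sO2.
  rewrite ffunE /=; case fv: (f v) => [a|] //; case fw: (f w) => [b|] //.
  rewrite sO1 ?(ov_bid ov fv fw vC wC) //.
  by apply: contraNneq nvw => eab; apply/eqP/(ov_inj ov fv); rewrite eab.
- rewrite !ffunE /= andbC; case: ifP => _ //.
  by case: (f v) => [a|]; case: (f w) => [b|].
Qed.

Lemma splice_ldl_param (th1 : param T1 F) (th2 : param T2 F) :
  supp_ok G1 th1 -> supp_ok G2 th2 -> nondeg rk1 th1.2 -> nondeg rk2 th2.2 ->
  exists2 N, tomx N \in unitmx &
  spl (ldl_param rk1 (phi th1)) (ldl_param rk2 (phi th2)) = congr_param N (spl th1 th2).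
Proof.
move=> s1 s2 nd1 nd2.
have bO1 := supp_block_closed (ov_closed1 ov) s1.
have bO2 := supp_block_closed (ov_closed2 ov) s2.
have u1 := supp_unitri (ov_ranked1 ov) s1.1; have u2 := supp_unitri (ov_ranked2 ov) s2.1.
rewrite !ldl_param_phi //.
have bN1 := ldl_factor_block nd1 bO1; have bN2 := ldl_factor_block nd2 bO2.
rewrite splice_congr //; eexists; last by [].
apply: (unitri_unit (rk := rk2)) => v w le_wv; rewrite ffunE /=.
case: ifP => [/andP[vC wC]|_]; last exact: ldl_factor_unitri.
have [a fv] := ov_total ov vC; have [b fw] := ov_total ov wC.
rewrite (pull_matE _ fv fw) ldl_factor_unitri ?(ov_rank ov fv) ?(ov_rank ov fw) //.
congr (nat_of_bool _)%:R; apply/eqP/eqP=> [eab|evw].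
  by apply: (ov_inj ov fv); rewrite eab.
by move: fv; rewrite evw fw => -[].
Qed.

(** The right-hand side involves [th1] and [th2] only through their images. So the image of a
    spliced pair is a function of the two images, and a rational one. *)
Lemma phi_splice (th1 : param T1 F) (th2 : param T2 F) :
  supp_ok G1 th1 -> supp_ok G2 th2 -> nondeg rk1 th1.2 -> nondeg rk2 th2.2 ->
  phi (spl th1 th2) =
  phi (spl (ldl_param rk1 (phi th1)) (ldl_param rk2 (phi th2))).
Proof.
move=> s1 s2 nd1 nd2; have [N uN ->] := splice_ldl_param s1 s2 nd1 nd2.
by rewrite phi_congr //; have [_ [_ []]] := splice_supp_ok s1 s2.
Qed.

Lemma phi_splice_congr (th1 th1' : param T1 F) (th2 th2' : param T2 F) :
  supp_ok G1 th1 -> supp_ok G2 th2 -> supp_ok G1 th1' -> supp_ok G2 th2' ->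
  nondeg rk1 th1.2 -> nondeg rk2 th2.2 -> phi th1 = phi th1' -> phi th2 = phi th2' ->
  phi (spl th1 th2) = phi (spl th1' th2').
Proof.
move=> s1 s2 s1' s2' nd1 nd2 e1 e2.
have nd1' : nondeg rk1 th1'.2.
  apply/(nondeg_phi (supp_unitri (ov_ranked1 ov) s1'.1)); rewrite -e1.
  exact/(nondeg_phi (supp_unitri (ov_ranked1 ov) s1.1)).
have nd2' : nondeg rk2 th2'.2.
  apply/(nondeg_phi (supp_unitri (ov_ranked2 ov) s2'.1)); rewrite -e2.
  exact/(nondeg_phi (supp_unitri (ov_ranked2 ov) s2.1)).
by rewrite phi_splice // e1 e2 -phi_splice.
Qed.

Lemma rational_splice X I (c : X -> I -> F) (P : X -> Prop)
    (th1 : X -> param T1 F) (th2 : X -> param T2 F) :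
  (forall i, rational_on c P (fun x => coords (th1 x) i)) ->
  (forall i, rational_on c P (fun x => coords (th2 x) i)) ->
  forall i, rational_on c P (fun x => coords (spl (th1 x) (th2 x)) i).
Proof.
move=> r1 r2.
have rp1 p : rational_on c P (fun x => pull_mat f (th1 x).1 p).
  case fv: (f p.1) => [a|]; last first.
    by apply: rational_ext (rational_const _ _ 0) => x _; rewrite ffunE fv.
  case fw: (f p.2) => [b|]; last first.
    by apply: rational_ext (rational_const _ _ 0) => x _; rewrite ffunE fv fw.
  by apply: rational_ext (r1 (inl (a, b))) => x _; rewrite ffunE fv fw.
have rp2 p : rational_on c P (fun x => pull_mat f (th1 x).2 p).
  case fv: (f p.1) => [a|]; last first.
    by apply: rational_ext (rational_const _ _ 0) => x _; rewrite ffunE fv.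
  case fw: (f p.2) => [b|]; last first.
    by apply: rational_ext (rational_const _ _ 0) => x _; rewrite ffunE fv fw.
  by apply: rational_ext (r1 (inr (a, b))) => x _; rewrite ffunE fv fw.
case=> p /=.
  case pC: (p.2 \in C2).
    by apply: rational_ext (rp1 p) => x _; rewrite [RHS]ffunE pC.
  by apply: rational_ext (r2 (inl p)) => x _; rewrite ffunE pC.
case pC: ((p.1 \in C2) && (p.2 \in C2)).
  by apply: rational_ext (rp2 p) => x _; rewrite [RHS]ffunE pC.
by apply: rational_ext (r2 (inr p)) => x _; rewrite ffunE pC.
Qed.

Lemma rational_phi_splice X I (c : X -> I -> F) (P : X -> Prop)
    (th1 : X -> param T1 F) (th2 : X -> param T2 F) :
  (forall x, P x -> [/\ supp_ok G1 (th1 x), supp_ok G2 (th2 x),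
                       nondeg rk1 (th1 x).2 & nondeg rk2 (th2 x).2]) ->
  (forall p, rational_on c P (fun x => phi (th1 x) p)) ->
  (forall p, rational_on c P (fun x => phi (th2 x) p)) ->
  forall p, rational_on c P (fun x => phi (spl (th1 x) (th2 x)) p).
Proof.
move=> okP r1 r2 p.
apply: (@rational_ext _ _ _ _ _ (fun x =>
  phi (spl (ldl_param rk1 (phi (th1 x))) (ldl_param rk2 (phi (th2 x)))) p)) => [x|].
  by case/okP=> *; rewrite -phi_splice.
have ndphi (T : finType) (G : mgraph T) rk (th : param T F) : ranked G rk ->
    supp_ok G th -> nondeg rk th.2 -> nondeg rk (phi th).
  by move=> rkG sG; apply: (nondeg_phi (supp_unitri rkG sG.1)).2.
apply: rational_phi => [x /okP[s1 s2 nd1 nd2]|].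
  have [N uN ->] := splice_ldl_param s1 s2 nd1 nd2.
  rewrite idm_sub_congr tomx_mul unitmx_mul uN andbT.
  by have [_ [_ []]] := splice_supp_ok s1 s2.
apply: rational_splice; apply: rational_ldl_param => // x /okP[s1 s2 nd1 nd2].
  exact: ndphi (ov_ranked1 ov) s1 nd1.
exact: ndphi (ov_ranked2 ov) s2 nd2.
Qed.

(** Only entries in rows without counterpart could be lost in the round trip. Parents of [C2] all
    have one, so those entries of [Lambda] are zero by the support condition. *)
Lemma spliceK g (th : param T2 F) x : (forall v a, f v = Some a -> g a = Some v) ->
  supp_ok G2 th -> spl (splice g C1 th x) th = th.
Proof.
move=> fK [sL _]; rewrite [RHS]surjective_pairing; congr pair.
  apply/ffunP=> -[v w]; rewrite ffunE /=; case: ifP => // wC.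
  have [b fw] := ov_total ov wC; rewrite ffunE /= fw.
  case fv: (f v) => [a|]; last first.
    by rewrite sL //; apply/negP=> /(ov_parent ov wC)[a]; rewrite fv.
  by rewrite !ffunE /= (ov_mem ov fw) wC (fK _ _ fv) (fK _ _ fw).
apply/ffunP=> -[v w]; rewrite ffunE /=; case: ifP => // /andP[vC wC].
have [b fw] := ov_total ov wC; have [a fv] := ov_total ov vC; rewrite ffunE /= fw fv.
by rewrite !ffunE /= (ov_mem ov fw) (ov_mem ov fv) vC wC (fK _ _ fv) (fK _ _ fw).
Qed.

End Splice.

(** The quadratic form splits into the form of [th1] at [x1], the part of [x] on the component, and
    the form of [th2] at [x2], the rest; the cross terms vanish since both matrices are block
    closed. *)
Lemma splice_posdef (F : numFieldType) (T1 T2 : finType) (G1 : mgraph T1)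
    (G2 : mgraph T2) rk1 rk2 (C1 : {set T1}) (C2 : {set T2}) f
    (th1 : param T1 F) (th2 : param T2 F) :
  overlap G1 G2 rk1 rk2 C1 C2 f -> supp_ok G1 th1 -> supp_ok G2 th2 ->
  posdef th1.2 -> posdef th2.2 -> posdef (splice f C2 th1 th2).2.
Proof.
move=> ov s1 s2 /posdefP p1 /posdefP p2; apply/posdefP=> x [u0 xu0].
have bO1 := supp_block_closed (ov_closed1 ov) s1.
have bO2 := supp_block_closed (ov_closed2 ov) s2.
(* By injectivity of [f] the sum has at most one term: it transports [x] from [C2] to [C1] and is 0
   outside [C1]. *)
pose x1 a := \sum_(v | (v \in C2) && (f v == Some a)) x v.
pose x2 v := if v \in C2 then 0 else x v.
have x1E v a : f v = Some a -> x1 a = if v \in C2 then x v else 0.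
  move=> fv; case: ifP => vC.
    rewrite /x1 (big_pred1 v) // => u; apply/andP/eqP=> [[uC /eqP fu]|->].
      exact: (ov_inj ov fu fv).
    by rewrite vC fv eqxx.
  rewrite /x1 big_pred0 // => u; apply/negP=> /andP[uC /eqP fu].
  by rewrite (ov_inj ov fu fv) vC in uC.
have x1_0 a : a \notin C1 -> x1 a = 0.
  move=> aC; rewrite /x1 big_pred0 // => u; apply/negP=> /andP[uC /eqP fu].
  by rewrite (ov_mem ov fu) uC in aC.
have -> : \sum_u \sum_v x u * (splice f C2 th1 th2).2 (u, v) * x v =
    \sum_a \sum_b x1 a * th1.2 (a, b) * x1 b +
    \sum_u \sum_v x2 u * th2.2 (u, v) * x2 v.
  rewrite (sum_overlap ov) => [|a aC]; last first.
    by rewrite big1 // => b _; rewrite x1_0 // !mul0r.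
  rewrite -big_split; apply: eq_bigr => u _ /=.
  have -> : oapp (fun a => \sum_b x1 a * th1.2 (a, b) * x1 b) 0 (f u) =
      \sum_v oapp (fun b => oapp (fun a => x1 a * th1.2 (a, b) * x1 b) 0 (f u)) 0 (f v).
    case fu: (f u) => [a|] /=.
      by rewrite (sum_overlap ov) // => b bC; rewrite (x1_0 b bC) mulr0.
    by rewrite big1 // => v _; case: (f v).
  rewrite -big_split; apply: eq_bigr => v _ /=.
  rewrite ffunE /= /x2; have [uC|uC] := boolP (u \in C2); last first.
    rewrite [oapp _ _ _](_ : _ = 0); last first.
      by case: (f v) => [b|] //=; case fu: (f u) => [a|] //=; rewrite (x1E _ _ fu) (negbTE uC) !mul0r.
    rewrite add0r /=; case: ifP => // vC; rewrite mulr0.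
    by rewrite bO2 ?mulr0 ?mul0r // vC (negbTE uC).
  have [a fu] := ov_total ov uC; rewrite !mul0r addr0 fu /=.
  have [vC|vC] := boolP (v \in C2); last first.
    rewrite /= bO2 ?mulr0 ?mul0r ?uC ?(negbTE vC) //.
    by case fv: (f v) => [b|] //=; rewrite (x1E _ _ fv) (negbTE vC) mulr0.
  have [b fv] := ov_total ov vC.
  by rewrite fv /= (pull_matE _ fu fv) (x1E _ _ fu) (x1E _ _ fv) uC vC.
have ge0 (T : finType) (O : mat T F) (y : T -> F) :
    (forall y : T -> F, (exists u, y u != 0) -> 0 < \sum_u \sum_v y u * O (u, v) * y v) ->
    0 <= \sum_u \sum_v y u * O (u, v) * y v.
  move=> pO; have [/existsP y0|] := boolP [exists u, y u != 0]; first exact/ltW/pO.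
  rewrite negb_exists => /forallP y0; rewrite big1 // => u _; rewrite big1 // => v _.
  by have := y0 u; rewrite negbK => /eqP ->; rewrite !mul0r.
have [uC|uC] := boolP (u0 \in C2).
  have [a fu] := ov_total ov uC; rewrite ltr_pwDl ?ge0 // p1 //.
  by exists a; rewrite (x1E _ _ fu) uC.
by rewrite ltr_wpDl ?ge0 // p2 //; exists u0; rewrite /x2 (negbTE uC).
Qed.

Lemma splice_ThetaR (F : numFieldType) (T1 T2 : finType) (G1 : mgraph T1)
    (G2 : mgraph T2) rk1 rk2 (C1 : {set T1}) (C2 : {set T2}) f
    (th1 : param T1 F) (th2 : param T2 F) :
  overlap G1 G2 rk1 rk2 C1 C2 f -> ThetaR G1 th1 -> ThetaR G2 th2 ->
  ThetaR G2 (splice f C2 th1 th2).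
Proof.
move=> ov [s1 p1] [s2 p2]; split; first exact: (splice_supp_ok ov).
exact: (splice_posdef ov).
Qed.

Section GenericSplice.
Context (T1 T2 : finType) (F : numFieldType) (f : T2 -> option T1) (C2 : {set T2}).
Variables (Th1 : param T1 F -> Prop) (Th2 : param T2 F -> Prop).
Hypothesis spliceTh : forall x b, Th1 x -> Th2 b -> Th2 (splice f C2 x b).
Hypothesis splice_surj : forall b, Th2 b -> exists2 x, Th1 x & splice f C2 x b = b.

Lemma poly_on_splice n b : is_poly n -> Th2 b -> n (coords b) != 0 ->
  exists2 q, poly_on Th1 q & forall x, Th1 x ->
    (q (coords x) != 0) = (n (coords (splice f C2 x b)) != 0).
Proof.
move=> pn Tb nb; apply: rational_poly_on.
  apply: rational_poly => //; apply: rational_splice => i; last exact: rational_const.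
  exact: rational_coord.
by have [x Tx xb] := splice_surj Tb; exists x; rewrite xb.
Qed.

(** The base [b] is chosen off the exceptional set. Since some [x] splices back to [b] itself, the
    pulled back polynomial is not identically zero. The conclusion [Q b b] later supplies a
    nondegenerate base. *)
Lemma generic_splice Q : generic Th2 Q ->
  exists b, [/\ Th2 b, Q b b &
    generic Th1 (fun x x' => Q (splice f C2 x b) (splice f C2 x' b))].
Proof.
move=> [n [pn [b [Tb nb]]] nQ]; exists b; split=> //; first exact: nQ.
have [q pq qn] := poly_on_splice pn Tb nb; exists q => // x x' Tx qx Tx' qx'.
by apply: nQ; rewrite -?qn //; apply: spliceTh.
Qed.

End GenericSplice.

(** * Mixed components of an acyclic graph *)

Definition n_ancestors (T : finType) (G : mgraph T) (v : T) : nat :=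
  #|[set u | connect (dir G) u v]|.

(** Along an edge from [v] to [w] the ancestors of [v] remain ancestors of [w], and [w] itself is
    new, since otherwise it would lie on a cycle. *)
Lemma acyclic_ranked (T : finType) (G : mgraph T) :
  acyclic G -> ranked G (n_ancestors G).
Proof.
move=> acG v w dvw; apply/proper_card/properP; split.
  by apply/subsetP=> u; rewrite !inE => uv; apply: connect_trans uv (connect1 dvw).
exists w; rewrite inE ?connect0 //; apply/negP=> /connectP[p pp lv].
have := acG w (rcons p w); rewrite rcons_path pp -lv last_rcons => /(_ dvw erefl).
by case: (p).
Qed.

Section Components.
Context (T : finType) (G : mgraph T).
Hypothesis symB : symmetric (bid G).

Lemma comps_closed C : C \in comps G -> bid_closed G C.
Proof.
move=> /imsetP[u _ ->] v w bvw; rewrite !inE; apply/idP/idP=> uv.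
  exact: connect_trans uv (connect1 bvw).
by apply: connect_trans uv (connect1 _); rewrite symB.
Qed.

Lemma comps_disjoint C D v : C \in comps G -> D \in comps G ->
  v \in C -> v \in D -> C = D.
Proof.
have symc : connect_sym (bid G) by apply: sym_connect_sym.
move=> /imsetP[u _ ->] /imsetP[t _ ->]; rewrite !inE => uv tv.
by apply/setP=> w; rewrite !inE (same_connect symc uv) (same_connect symc tv).
Qed.

Lemma comps_cover v : exists2 C, C \in comps G & v \in C.
Proof.
exists [set w | connect (bid G) v w]; first exact: imset_f.
by rewrite inE.
Qed.

Context (F : fieldType) (rk : T -> nat).
Hypothesis rkG : ranked G rk.

Definition agree_on (C : {set T}) (th th' : param T F) : Prop :=
  (forall v w, w \in C -> th.1 (v, w) = th'.1 (v, w)) /\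
  (forall v w, v \in C -> w \in C -> th.2 (v, w) = th'.2 (v, w)).

(** Each column of [Lambda] belongs to a component, and entries of [Omega] between two components
    vanish. *)
Lemma agree_on_all th th' : supp_ok G th -> supp_ok G th' ->
  (forall C, C \in comps G -> agree_on C th th') -> th = th'.
Proof.
move=> [_ [sO _]] [_ [sO' _]] agr.
rewrite [th]surjective_pairing [th']surjective_pairing.
congr pair; apply/ffunP=> -[v w].
  by have [C CG wC] := comps_cover w; apply: (agr C CG).1.
have [C CG wC] := comps_cover w.
have [vC|vC] := boolP (v \in C); first exact: (agr C CG).2.
have nvw : v != w by apply: contraNneq vC => ->.
have nb : ~~ bid G v w by apply: contra vC => /(comps_closed CG) ->.
by rewrite sO // sO'.
Qed.

Section Component.
Variable C : {set T}.
Hypothesis CG : C \in comps G.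
Local Notation GC := (comp_graph G C).
Local Notation TC := (comp_type G C).
Implicit Types (th : param T F) (x y b : param TC F).

Definition comp_rank (v : TC) : nat := rk (val v).
Definition comp_core : {set TC} := [set x : TC | val x \in C].
(** The inclusion is total; the option fits it to [overlap], which also has to describe the partial
    map backwards. *)
Definition to_comp (x : TC) : option T := Some (val x).
Definition of_comp (v : T) : option TC := insub v.

Lemma of_compE v (x : TC) : (of_comp v = Some x) <-> (val x = v).
Proof.
rewrite /of_comp; split=> [|<-]; last exact: valK.
by case: insubP => // y _ <- [->].
Qed.

Lemma to_comp_overlap : overlap G GC rk comp_rank C comp_core to_comp.
Proof.
split=> //.
- by move=> u v a [<-] [/val_inj].
- by move=> v a [<-]; rewrite inE.
- move=> a aC; have aN : a \in comp_nodes G C by rewrite inE aC.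
  by exists (Sub a aN); rewrite /to_comp SubK.
- by move=> v _; exists (val v).
- by move=> v w _ _; exists (val v).
- by move=> v w a b [<-] [<-]; rewrite inE /= => ->; rewrite andbT.
- by move=> v w a b [<-] [<-]; rewrite !inE /= => -> ->; rewrite !andbT.
- by move=> v a [<-].
- by move=> v w /andP[/rkG].
- exact: comps_closed.
- by move=> v w /and3P[_ vC wC]; rewrite !inE vC wC.
Qed.

Lemma of_comp_overlap : overlap GC G comp_rank rk comp_core C of_comp.
Proof.
have inN v : v \in comp_nodes G C -> exists x : TC, of_comp v = Some x.
  by move=> vN; exists (Sub v vN); apply/of_compE; rewrite SubK.
split=> //.
- by move=> u v a /of_compE <- /of_compE <-.
- by move=> v a /of_compE <-; rewrite inE.
- by move=> a _; exists (val a); apply/of_compE.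
- by move=> v vC; apply: inN; rewrite inE vC.
- move=> v w wC dvw; apply: inN; rewrite inE; apply/orP; right.
  by apply/bigcupP; exists w; rewrite // inE.
- by move=> v w a b /of_compE <- /of_compE <- /= ->; rewrite andbT.
- by move=> v w a b /of_compE <- /of_compE <- /= -> ->; rewrite !andbT.
- by move=> v a /of_compE <-.
- by move=> v w /andP[/rkG].
- by move=> v w /and3P[_ vC wC]; rewrite !inE vC wC.
- exact: comps_closed.
Qed.

(** The base [b] provides what [th] does not determine, namely the variances of the parents outside
    [C]. *)
Definition restrict (th : param T F) (b : param TC F) : param TC F :=
  splice to_comp comp_core th b.
Definition extend (x : param TC F) (th : param T F) : param T F :=
  splice of_comp C x th.

Lemma restrictK th b : supp_ok G th -> extend (restrict th b) th = th.
Proof. by apply: (spliceK of_comp_overlap) => v a /of_compE <-. Qed.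

Lemma extendK x th : supp_ok GC x -> restrict (extend x th) x = x.
Proof. by apply: (spliceK to_comp_overlap) => v a [<-]; apply/of_compE. Qed.

Lemma ranked_comp : ranked GC comp_rank.
Proof. exact: ov_ranked2 to_comp_overlap. Qed.

Lemma nondeg_fiber x y : supp_ok GC x -> supp_ok GC y -> phi x = phi y ->
  nondeg comp_rank x.2 -> nondeg comp_rank y.2.
Proof.
move=> sx sy exy ndx; apply/(nondeg_phi (supp_unitri ranked_comp sy.1)).
rewrite -exy; exact/(nondeg_phi (supp_unitri ranked_comp sx.1)).
Qed.

Lemma comp_outer_var x v : supp_ok GC x -> nondeg comp_rank x.2 ->
  v \notin comp_core -> (ldl_param comp_rank (phi x)).2 (v, v) = x.2 (v, v).
Proof.
move=> sx ndx vC; apply: ldl_param_singleton => //.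
  by apply: (supp_unitri ranked_comp); apply: sx.1.
apply: (supp_block_closed (G := GC)) => // u w /and3P[_ uC wC]; rewrite !inE.
apply/eqP/eqP=> e; case/negP: vC; rewrite -e inE //.
Qed.

(** The base enters only outside the core, where [Lambda] vanishes and [Omega] has just the outer
    variances, and these are determined by [phi x]. *)
Lemma restrict_base x y th : supp_ok GC x -> supp_ok GC y ->
  nondeg comp_rank x.2 -> phi x = phi y -> restrict th x = restrict th y.
Proof.
move=> sx sy ndx exy; have ndy := nondeg_fiber sx sy exy ndx.
congr pair; apply/ffunP=> -[v w]; rewrite [LHS]ffunE [RHS]ffunE /=.
  case: ifP => // /negbT wC; have nd : ~~ dir GC v w.
    by apply: contra wC => /andP[_]; rewrite inE.
  by rewrite sx.1 // sy.1.
case: ifP => // /negbT; rewrite negb_and => vwC.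
have [evw|nvw] := eqVneq v w.
  have vC : v \notin comp_core by case/orP: vwC; rewrite ?evw.
  rewrite -evw; apply: etrans (esym (comp_outer_var sx ndx vC)) _.
  by rewrite exy; apply: comp_outer_var sy ndy vC.
have nb : ~~ bid GC v w.
  by case/orP: vwC => nC; apply: contra nC => /and3P[]; rewrite inE.
by rewrite sx.2.1 // sy.2.1.
Qed.

(** A point [x] of the fibre has the same outer variances as [b], so completing its core with [b]
    instead of [x] changes nothing. *)
Lemma restrict_fiber x th th' b : supp_ok GC x -> nondeg comp_rank x.2 ->
  supp_ok GC (restrict th b) -> phi x = phi (restrict th b) ->
  restrict (extend x th') b = x.
Proof.
move=> sx ndx sr exr; rewrite -[RHS](extendK th' sx) (restrict_base _ sx sr) //.
by rewrite [RHS]splice_splice.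
Qed.

Lemma agree_restrict th th' b : agree_on C th th' -> restrict th b = restrict th' b.
Proof.
move=> [aL aO]; congr pair; apply/ffunP=> -[v w]; rewrite [LHS]ffunE [RHS]ffunE /=.
  by rewrite inE; case: ifP => // wC; rewrite !ffunE /= aL.
by rewrite !inE; case: ifP => // /andP[vC wC]; rewrite !ffunE /= aO.
Qed.

Lemma agree_extend x th th' : agree_on C (extend x th) (extend x th').
Proof.
split=> v w wC; rewrite [LHS]ffunE [RHS]ffunE /= ?wC // => ->.
by [].
Qed.

Lemma restrict_agree th th' b : supp_ok G th -> supp_ok G th' ->
  restrict th b = restrict th' b -> agree_on C th th'.
Proof.
move=> sth sth' er; rewrite -(restrictK b sth) -(restrictK b sth') er.
exact: agree_extend.
Qed.

Lemma agree_extend_restrict th th' b : supp_ok G th ->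
  agree_on C (extend (restrict th b) th') th.
Proof. by move=> sth; rewrite -{2}(restrictK b sth); apply: agree_extend. Qed.

Lemma extend_agree th th' b : supp_ok G th' -> agree_on C th' th ->
  extend (restrict th b) th' = th'.
Proof. by move=> sth' /agree_restrict <-; apply: restrictK. Qed.

Lemma agree_extend_other D x th : D \in comps G -> D != C -> agree_on D (extend x th) th.
Proof.
move=> DG nDC; have nC v : v \in D -> v \in C = false.
  by move=> vD; apply: contraNF nDC => vC; apply/eqP/(comps_disjoint DG CG vD vC).
by split=> v w; [|move=> _]; move=> /nC wC; rewrite ffunE /= wC ?andbF.
Qed.

Lemma extend_extend x y th : extend x (extend y th) = extend x th.
Proof. exact: splice_splice. Qed.

Lemma phi_extend x y th : supp_ok GC x -> supp_ok GC y -> supp_ok G th ->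
  nondeg comp_rank x.2 -> nondeg rk th.2 -> phi x = phi y ->
  phi (extend x th) = phi (extend y th).
Proof. by move=> *; apply: (phi_splice_congr of_comp_overlap). Qed.

Lemma phi_restrict th th' b : supp_ok G th -> supp_ok G th' -> supp_ok GC b ->
  nondeg rk th.2 -> nondeg comp_rank b.2 -> phi th = phi th' ->
  phi (restrict th b) = phi (restrict th' b).
Proof. by move=> *; apply: (phi_splice_congr to_comp_overlap). Qed.

Lemma extend_supp_ok x th : supp_ok GC x -> supp_ok G th -> supp_ok G (extend x th).
Proof. by move=> sx sth; apply: (splice_supp_ok of_comp_overlap). Qed.

Lemma restrict_supp_ok th b : supp_ok G th -> supp_ok GC b -> supp_ok GC (restrict th b).
Proof. by move=> sth sb; apply: (splice_supp_ok to_comp_overlap). Qed.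

Lemma phi_extend_fiber x th b : supp_ok GC x -> supp_ok G th -> supp_ok GC b ->
  nondeg comp_rank x.2 -> nondeg rk th.2 -> phi x = phi (restrict th b) ->
  phi (extend x th) = phi th.
Proof.
move=> sx sth sb ndx ndth ex; rewrite -[in RHS](restrictK b sth).
by apply: phi_extend => //; apply: restrict_supp_ok.
Qed.

(** Since [extend] forgets the outer variances, injectivity can only be expected inside a fibre,
    where they are constant. *)
Lemma extend_inj x x' th : supp_ok GC x -> supp_ok GC x' ->
  nondeg comp_rank x.2 -> phi x = phi x' -> extend x th = extend x' th -> x = x'.
Proof.
move=> sx sx' ndx exx' ee; rewrite -(extendK th sx) -(extendK th sx') ee.
exact: restrict_base.
Qed.

End Component.
End Components.

Lemma exists_proper_alg1 (T : finType) (F : numFieldType) (Th : param T F -> Prop)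
    (Q : param T F -> Prop) :
  (exists W, proper_alg Th W /\ forall th, Th th -> ~ W th -> Q th) <->
  generic Th (fun th _ => Q th).
Proof.
rewrite -exists_proper_alg; split=> -[W [pW WQ]]; exists W; split=> //.
  by move=> th _ Tth Wth _ _; apply: WQ.
by move=> th Tth Wth; apply: (WQ th th).
Qed.

(** * Rational and generic identifiability over a real closed field *)

Section Real.
Context (R : rcfType) (T : finType) (G : mgraph T) (rk : T -> nat).
Hypotheses (symB : symmetric (bid G)) (rkG : ranked G rk).

Lemma ThetaR_nondeg (S : finType) (H : mgraph S) r (th : param S R) :
  ThetaR H th -> nondeg r th.2.
Proof. by move=> [_]; apply: posdef_nondeg. Qed.

Local Notation Theta := (@ThetaR T R G).

Lemma Theta_inhabited : exists th, Theta th.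
Proof. by exists (0, idm T R); apply: ThetaR_id rkG. Qed.

Section OneComponent.
Variable C : {set T}.
Hypothesis CG : C \in comps G.
Local Notation GC := (comp_graph G C).
Local Notation TC := (comp_type G C).
Local Notation ThetaC := (@ThetaR TC R GC).
Implicit Types (th : param T R) (x y b : param TC R).

Lemma comp_Theta_inhabited : exists x, ThetaC x.
Proof. by exists (0, idm TC R); apply: ThetaR_id (ranked_comp symB rkG CG). Qed.

Lemma extend_Theta x th : ThetaC x -> Theta th -> Theta (extend x th).
Proof. exact: splice_ThetaR (of_comp_overlap symB rkG CG). Qed.

Lemma restrict_Theta th b : Theta th -> ThetaC b -> ThetaC (restrict th b).
Proof. exact: splice_ThetaR (to_comp_overlap symB rkG CG). Qed.

Lemma extend_surj th : Theta th -> exists2 x, ThetaC x & extend x th = th.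
Proof.
move=> Tth; have [b Tb] := comp_Theta_inhabited.
exists (restrict th b); first exact: restrict_Theta.
by apply: (restrictK symB rkG CG); case: Tth.
Qed.

Lemma restrict_surj b : ThetaC b -> exists2 th, Theta th & restrict th b = b.
Proof.
move=> Tb; have [th Tth] := Theta_inhabited.
exists (extend b th); first exact: extend_Theta.
by apply: (extendK symB rkG CG); case: Tb.
Qed.

Lemma generic_extend Q : generic Theta Q ->
  exists th, [/\ Theta th, Q th th &
    generic ThetaC (fun x x' => Q (extend x th) (extend x' th))].
Proof. by apply: generic_splice; [apply: extend_Theta | apply: extend_surj]. Qed.

Lemma generic_restrict Q : generic ThetaC Q ->
  exists b, [/\ ThetaC b, Q b b &
    generic Theta (fun th th' => Q (restrict th b) (restrict th' b))].
Proof. by apply: generic_splice; [apply: restrict_Theta | apply: restrict_surj]. Qed.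

End OneComponent.

(** In one direction two points with equal image for $G_C$ are planted into the same [th]; in the
    other, equal images for $G$ give equal images of all restrictions, and the finitely many generic
    conditions are combined. *)
Lemma gen_ident_comps :
  gen_ident R G <-> forall C, C \in comps G -> gen_ident R (comp_graph G C).
Proof.
split=> [gi C CG | gi].
  have /exists_proper_alg gQ := gi.
  have [th [Tth _ gC]] := generic_extend CG gQ.
  apply/exists_proper_alg; apply: generic_sub gC => x x' [sx px] [sx' px'] Q exx'.
  have ndx := posdef_nondeg (rk := comp_rank rk (C := C)) px.
  have ndth := ThetaR_nondeg (r := rk) Tth.
  apply: (extend_inj symB rkG CG sx sx' ndx exx' (Q _)).
  exact: (phi_extend symB rkG CG sx sx' Tth.1 ndx ndth).
have gC C : C \in enum (comps G) ->
    generic Theta (fun th th' => phi th = phi th' -> agree_on C th th').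
  rewrite mem_enum => CG; have /exists_proper_alg gQ := gi C CG.
  have [b [Tb _ gG]] := generic_restrict CG gQ.
  apply: generic_sub gG => th th' [sth pth] [sth' pth'] Q eth.
  apply: (restrict_agree symB rkG CG sth sth' (Q _)).
  apply: (phi_restrict symB rkG CG sth sth' Tb.1) => //.
    exact: posdef_nondeg.
  exact: posdef_nondeg Tb.2.
apply/exists_proper_alg.
have := generic_all (ThetaR_segment rkG) Theta_inhabited gC.
apply: generic_sub => th th' [sth _] [sth' _] Q eth.
apply: (agree_on_all symB sth sth') => C CG; apply: Q => //; by rewrite mem_enum.
Qed.

(** Coordinatewise form: each coordinate may have its own exceptional set, which allows a different
    argument for each kind of coordinate. *)
Definition rational_ident_at (S : finType) (H : mgraph S) (i : S * S + S * S) : Prop :=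
  exists2 n, poly_on (@ThetaR S R H) n &
    rational_on (fun (th : param S R) p => phi th p)
      (fun th => ThetaR H th /\ n (coords th) != 0) (fun th => coords th i).

Lemma rational_ident_const (S : finType) (H : mgraph S) i a :
  (exists th, @ThetaR S R H th) -> (forall th : param S R, ThetaR H th -> coords th i = a) ->
  rational_ident_at H i.
Proof.
move=> [th0 Tth0] ia; exists (fun=> 1).
  by split; [apply: Poly_const | exists th0; rewrite oner_eq0].
by apply: rational_ext (rational_const _ _ a) => th [Tth _]; rewrite ia.
Qed.

Lemma rat_identP (S : finType) (H : mgraph S) r : ranked H r ->
  rat_ident R H <-> forall i, rational_ident_at H i.
Proof.
move=> rH; split=> [[W [pW [num [den [pnd nd]]]]] i | ri].
  have [n pn nW] := proper_alg_poly pW; exists n => //.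
  exists (num i), (den i); split; [exact: (pnd i).1 | exact: (pnd i).2 |].
  by move=> th [Tth nth]; apply: nd => //; apply: nW.
(* Finite choice of the exceptional polynomial, numerator and denominator for all coordinates at
   once. *)
have [f fP] : exists f, forall i, let: (n, nm, dn) := f i in
    [/\ poly_on (@ThetaR S R H) n, is_poly nm, is_poly dn & forall th,
      ThetaR H th /\ n (coords th) != 0 ->
      dn (phi th) != 0 /\ nm (phi th) / dn (phi th) = coords th i].
  apply: (@fin_all_exists _ (fun=> _) (fun i nf => let: (n, nm, dn) := nf in _)) => i.
  by have [n pn [nm [dn [pnm pdn nd]]]] := ri i; exists (n, nm, dn); split.
have inh : exists th, @ThetaR S R H th by exists (0, idm S R); apply: ThetaR_id rH.
pose num i := (f i).1.2; pose den i := (f i).2.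
have gi i : i \in enum {: S * S + S * S} -> generic (@ThetaR S R H)
    (fun th _ => den i (phi th) != 0 /\ num i (phi th) / den i (phi th) = coords th i).
  move=> _; rewrite /num /den; have := fP i; case: (f i) => [[n nm] dn] [pn _ _ nd].
  by exists n => // th th' Tth nth _ _; apply: nd.
have /exists_proper_alg1[W [pW WQ]] := generic_sub
  (Q' := fun th _ => forall i, den i (phi th) != 0 /\
    num i (phi th) / den i (phi th) = coords th i)
  (fun _ _ _ _ Q i => Q i (mem_enum _ i)) (generic_all (ThetaR_segment rH) inh gi).
exists W; split=> //; exists num, den; split=> // i.
by rewrite /num /den; have := fP i; case: (f i) => [[n nm] dn] [].
Qed.

Lemma rat_ident_comps :
  rat_ident R G <-> forall C, C \in comps G -> rat_ident R (comp_graph G C).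
Proof.
have ratG := rat_identP rkG.
split=> [/ratG ri C CG | ri].
  apply/(rat_identP (ranked_comp symB rkG CG)).
  have inh := comp_Theta_inhabited CG.
  have core i j : (forall (th : param T R) x,
      coords (extend x th) i = coords x j) -> rational_ident_at (comp_graph G C) j.
    move=> eij; have [n [pn [th0 [Tth0 nth0]]] rn] := ri i.
    have [q pq qn] := poly_on_splice (extend_surj CG) pn Tth0 nth0.
    exists q => //; apply: (@rational_ext _ _ _ _ _ (fun x => coords (extend x th0) i)).
      by move=> x _; apply: eij.
    apply: rational_comp rn; last first.
      by move=> x [Tx]; rewrite qn // => nx; split=> //; apply: extend_Theta.
    move=> p; apply: (rational_phi_splice (of_comp_overlap symB rkG CG)) => [x [[sx px] _]||].
    - split=> //; [exact: Tth0.1 | exact: posdef_nondeg |].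
      exact: posdef_nondeg Tth0.2.
    - by move=> {}p; apply: rational_coord.
    - by move=> {}p; apply: rational_const.
  case=> -[v w].
    have [wC|wC] := boolP (val w \in C); last first.
      apply: (rational_ident_const (a := 0) inh) => x [[sx _] _].
      by apply: sx; apply: contra wC => /andP[].
    apply: (core (inl (val v, val w))) => th x; rewrite /= ffunE /= wC ffunE /=.
    by rewrite /of_comp !valK.
  have [/andP[vC wC]|vwC] := boolP ((val v \in C) && (val w \in C)).
    apply: (core (inr (val v, val w))) => th x; rewrite /= ffunE /= vC wC ffunE /=.
    by rewrite /of_comp !valK.
  have [evw|nvw] := eqVneq v w; last first.
    apply: (rational_ident_const (a := 0) inh) => x [[_ [sx _]] _].
    by apply: sx => //; apply: contra vwC => /and3P[_ -> ->].
  (* The variance of an outer parent is not a coordinate of $G$, so identifiability of $G$ says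
     nothing about it. It is read off from the LDL data of [phi x]. *)
  have vC : v \notin comp_core G C.
    by rewrite inE; move: vwC; rewrite -evw andbb.
  have [x0 Tx0] := inh; exists (fun=> 1).
    by split; [apply: Poly_const | exists x0; rewrite oner_eq0].
  apply: (@rational_ext _ _ _ _ _
      (fun x : param (comp_type G C) R =>
         coords (ldl_param (comp_rank rk (C := C)) (phi x)) (inr (v, w)))) => [x [[sx px] _]|].
    rewrite -evw; apply: (comp_outer_var symB rkG CG sx _ vC); exact: posdef_nondeg.
  apply: rational_ldl_param => [x [[sx px] _]|p]; last exact: rational_coord.
  apply/(nondeg_phi (supp_unitri (ranked_comp symB rkG CG) sx.1)).
  exact: posdef_nondeg.
apply/ratG.
(* If coordinate [i] of $G$ appears as coordinate [j] of a component, the formula for [j] is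
   composed with the rational map from [phi th] to the image of the restriction. *)
have core C i j : C \in comps G ->
    (forall (th : param T R) (b : param (comp_type G C) R),
      supp_ok G th -> coords (restrict th b) j = coords th i) ->
    rational_ident_at G i.
  move=> CG eij.
  have /(rat_identP (ranked_comp symB rkG CG))/(_ j) := ri C CG.
  move=> [n [pn [b [Tb nb]]] rn].
  have [q pq qn] := poly_on_splice (restrict_surj CG) pn Tb nb.
  exists q => //; apply: (@rational_ext _ _ _ _ _ (fun th => coords (restrict th b) j)).
    by move=> th [[sth _] _]; apply: eij.
  apply: rational_comp rn; last first.
    by move=> th [Tth]; rewrite qn // => nth; split=> //; apply: restrict_Theta.
  move=> p; apply: (rational_phi_splice (to_comp_overlap symB rkG CG)) => [th [[sth pth] _]||].
  - split=> //; [exact: Tb.1 | exact: posdef_nondeg |].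
    exact: posdef_nondeg Tb.2.
  - by move=> {}p; apply: rational_coord.
  - by move=> {}p; apply: rational_const.
case=> -[v w]; have [C CG wC] := comps_cover G w.
  have [vN|vN] := boolP (dir G v w); last first.
    by apply: (rational_ident_const (a := 0) Theta_inhabited) => th [[sth _] _]; apply: sth.
  have [y fw] := ov_total (of_comp_overlap symB rkG CG) wC.
  have [x fv] := ov_parent (of_comp_overlap symB rkG CG) wC vN.
  have [ev ew] : val x = v /\ val y = w by split; apply/of_compE.
  apply: (core C _ (inl (x, y))) => // th b _; rewrite /= ffunE /= inE ew wC ffunE /=.
  by rewrite ev ew.
have [vC|vC] := boolP (v \in C); last first.
  apply: (rational_ident_const (a := 0) Theta_inhabited) => th [[_ [sth _]] _]; apply: sth.
    by apply: contraNneq vC => ->.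
  by apply: contra vC => /(comps_closed symB CG) ->.
have [y fw] := ov_total (of_comp_overlap symB rkG CG) wC.
have [x fv] := ov_total (of_comp_overlap symB rkG CG) vC.
have [ev ew] : val x = v /\ val y = w by split; apply/of_compE.
apply: (core C _ (inr (x, y))) => // th b _; rewrite /= ffunE /= !inE ev ew vC wC ffunE /=.
by rewrite ev ew.
Qed.

End Real.

(** * Infinite real fibres *)

Section Fibers.
Context (R : rcfType) (T : finType) (G : mgraph T) (rk : T -> nat).
Hypotheses (symB : symmetric (bid G)) (rkG : ranked G rk).
Implicit Types th : param T R.

Definition real_fiber (S : finType) (H : mgraph S) (th th' : param S R) : Prop :=
  ThetaR H th' /\ phi th' = phi th.

Lemma not_infinite_pred (E : eqType) (P : E -> Prop) :
  ~ infinite_pred P -> exists s : seq E, forall x, P x -> x \in s.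
Proof.
move=> /not_all_ex_not[s ns]; exists s => x Px; apply/negPn/negP=> xs.
by apply: ns; exists x.
Qed.

(** Induction on the list [cs] of components where a fibre point may differ from [th]. Such a point
    is recovered from its restriction to [C], one of finitely many, and from the point with its [C]
    part reset to that of [th], which is again in the fibre. *)
Lemma finite_fiber th (cs : seq {set T}) : ThetaR G th -> {subset cs <= comps G} ->
  (forall C, C \in cs -> exists2 b : param (comp_type G C) R,
     ThetaR (comp_graph G C) b &
     ~ infinite_pred (real_fiber (comp_graph G C) (restrict th b))) ->
  exists s : seq (param T R), forall th', real_fiber G th th' ->
    (forall D, D \in comps G -> D \notin cs -> agree_on D th' th) -> th' \in s.
Proof.
move=> Tth; elim: cs => [_ _|C cs IHs csG fin].
  exists [:: th] => th' [[sth' _] _] agr; rewrite inE; apply/eqP.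
  by apply: (agree_on_all symB sth' Tth.1) => C CG; apply: agr.
have [s sP] : exists s : seq (param T R), forall th', real_fiber G th th' ->
    (forall D, D \in comps G -> D \notin cs -> agree_on D th' th) -> th' \in s.
  by apply: IHs => D Ds; [apply: csG | apply: fin]; rewrite inE Ds orbT.
have CG : C \in comps G by apply: csG; rewrite mem_head.
have [b Tb /not_infinite_pred[sC sCP]] := fin C (mem_head _ _).
exists [seq extend x t | t <- s, x <- sC] => th' [Tth' eth'] agr.
have ndth := ThetaR_nondeg (r := rk) Tth; have ndth' := ThetaR_nondeg (r := rk) Tth'.
have ndb := ThetaR_nondeg (r := comp_rank rk (C := C)) Tb.
have Trb := restrict_Theta symB rkG CG Tth Tb.
have er : phi (restrict th' b) = phi (restrict th b).
  by apply: (phi_restrict symB rkG CG Tth'.1 Tth.1 Tb.1).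
apply/allpairsP; exists (extend (restrict th b) th', restrict th' b); split=> /=.
- apply: sP => [|D DG Ds].
    split; first exact: (extend_Theta symB rkG CG).
    rewrite -eth'; apply: (phi_extend_fiber symB rkG CG Trb.1 Tth'.1 Tb.1) => //.
    exact: ThetaR_nondeg Trb.
  have [->|nDC] := eqVneq D C; first exact: (agree_extend_restrict symB rkG CG _ _ Tth.1).
  have [aL aO] := agree_extend_other symB CG (restrict th b) th' DG nDC.
  have [aL' aO'] : agree_on D th' th by apply: agr; rewrite // inE negb_or nDC.
  by split=> v w *; [rewrite aL // aL' | rewrite aO // aO'].
- by apply: sCP; split; [apply: (restrict_Theta symB rkG CG) | apply: er].
- by rewrite extend_extend (restrictK symB rkG CG _ Tth'.1).
Qed.

Lemma gen_inf_comps :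
  gen_inf R G <-> exists2 C, C \in comps G & gen_inf R (comp_graph G C).
Proof.
split=> [/exists_proper_alg1[n [pn [th0 [Tth0 nth0]]] ninf] | [C CG /exists_proper_alg1 gi]].
  apply: NNPP => nC.
  (* Failure of generic infiniteness for [C] does not give generically finite fibres, only one
     finite fibre off any given proper algebraic subset. The point is therefore adjusted one
     component at a time, keeping [n] nonzero and the earlier restrictions unchanged. *)
  have noinf (cs : seq {set T}) : uniq cs -> {subset cs <= comps G} -> exists th,
      [/\ ThetaR G th, n (coords th) != 0 & forall C, C \in cs ->
        exists2 b : param (comp_type G C) R, ThetaR (comp_graph G C) b &
        ~ infinite_pred (real_fiber (comp_graph G C) (restrict th b))].
    elim: cs => [_ _|C cs IHs /andP[Ccs ucs] csG]; first by exists th0.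
    have [|th [Tth nth fin]] := IHs ucs.
      by move=> D Ds; apply: csG; rewrite inE Ds orbT.
    have CG : C \in comps G by apply: csG; rewrite mem_head.
    have [q pq qn] := poly_on_splice (extend_surj symB rkG CG) pn Tth nth.
    have [x [Tx qx nix]] : exists x, [/\ ThetaR (comp_graph G C) x, q (coords x) != 0 &
        ~ infinite_pred (real_fiber (comp_graph G C) x)].
      apply: NNPP => nx; apply: nC; exists C => //; apply/exists_proper_alg1.
      exists q => // x _ Tx qx _ _; apply: NNPP => nix; apply: nx; exists x.
      by split.
    exists (extend x th); split.
    - exact: (extend_Theta symB rkG CG).
    - by rewrite /extend -qn.
    move=> D; rewrite inE; have [-> _|nDC /= Ds] := eqVneq D C.
      by exists x; rewrite // (extendK symB rkG CG _ Tx.1).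
    have DG : D \in comps G by apply: csG; rewrite inE Ds orbT.
    have [b Tb nib] := fin D Ds; exists b => //.
    by rewrite (agree_restrict b (agree_extend_other symB CG x th DG nDC)).
  have [|th [Tth nth fin]] := noinf (enum (comps G)) (enum_uniq _).
    by move=> C; rewrite mem_enum.
  have [|s sP] := finite_fiber Tth _ fin; first by move=> C; rewrite mem_enum.
  have [th' [fth' /negP]] := ninf th th Tth nth Tth nth s; apply; apply: sP => // D DG.
  by rewrite mem_enum DG.
have [b [Tb _ gG]] := generic_restrict symB rkG CG gi.
apply/exists_proper_alg1; apply: generic_sub gG => th _ Tth _ inf s.
(* A fibre point for $G_C$ that avoids the restrictions of all members of [s] has an extension that
   avoids [s]. *)
have [x [[Tx ex] xs]] := inf [seq restrict t b | t <- s].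
have Trb := restrict_Theta symB rkG CG Tth Tb.
have ndx := ThetaR_nondeg (r := comp_rank rk (C := C)) Tx.
exists (extend x th); split.
  split; first exact: (extend_Theta symB rkG CG).
  apply: (phi_extend_fiber symB rkG CG Tx.1 Tth.1 Tb.1 ndx _ ex).
  exact: ThetaR_nondeg Tth.
apply: contra xs => es; apply/mapP; exists (extend x th) => //.
by rewrite (restrict_fiber symB rkG CG th Tx.1 ndx Trb.1 ex).
Qed.

End Fibers.

(** * Counting complex fibres *)

Section Complex.
Context (F : numFieldType) (T : finType).

Lemma nondeg_id rk : nondeg rk (idm T F).
Proof.
move=> k e e_hi e0 u; have [lt_uk|] := ltnP (rk u) k; last exact: e_hi.
rewrite -(e0 u lt_uk) (bigD1 u) //= ffunE eqxx mul1r big1 ?addr0 // => v nvu.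
by rewrite ffunE /= eq_sym (negbTE nvu) mul0r.
Qed.

Lemma generic_nondeg (G : mgraph T) rk : ranked G rk ->
  generic (@supp_ok T F G) (fun th _ => nondeg rk th.2).
Proof.
move=> rkG; pose K := (\max_u rk u).+1.
(* The last threshold [K] exceeds every rank and contributes the full determinant; larger ones
   repeat it. *)
pose f (th : param T F) := \prod_(k < K.+1) \det (lead_mx rk k th.2).
have ndf th : f th != 0 <-> nondeg rk th.2.
  rewrite nondeg_lead_mx; split=> [/prodf_neq0 nf k | uS].
    rewrite -lead_mx_large unitmxE unitfE.
    have lt_k : (minn k K < K.+1)%N by rewrite ltnS geq_minr.
    exact: (nf (Ordinal lt_k)).
  by apply/prodf_neq0=> k _; rewrite -unitfE -unitmxE.
have [|//|n pn nf] := @rational_poly_on T F (@supp_ok T F G) f.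
- apply: rational_prod => k _; apply: rational_det => i j.
  case lt_ij: ((rk (enum_val i) < k)%N && (rk (enum_val j) < k)%N).
    apply: rational_ext (rational_coord _ _ (inr (enum_val i, enum_val j))) => th _.
    by rewrite mxE lt_ij.
  by apply: rational_ext (rational_const _ _ (i == j)%:R) => th _; rewrite mxE lt_ij.
- exists (0, idm T F); split; first exact: supp_ok_id rkG.
  exact/ndf/nondeg_id.
by exists n => // th _ sth nth _ _; apply/ndf; rewrite -nf.
Qed.

End Complex.

Section Counting.
Context (F : fieldType) (T : finType) (G : mgraph T) (rk : T -> nat).
Hypotheses (symB : symmetric (bid G)) (rkG : ranked G rk).
Implicit Types th : param T F.

Definition fiber_list (S : finType) (H : mgraph S) (th : param S F) (h : nat) : Prop :=
  exists s : seq (param S F), [/\ uniq s, size s = h &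
    forall th' : param S F, (supp_ok H th' /\ phi th' = phi th) <-> th' \in s].

(** The induction of the finite real case made exact: fibre points correspond bijectively to pairs
    of a fibre point [t] equal to [th] on [C] and a fibre point [x] for $G_C$, so the cardinalities
    multiply. *)
Lemma fiber_list_comps th (h : {set T} -> nat) (cs : seq {set T}) :
  supp_ok G th -> nondeg rk th.2 -> uniq cs -> {subset cs <= comps G} ->
  (forall C, C \in cs -> exists b : param (comp_type G C) F,
     [/\ supp_ok (comp_graph G C) b, nondeg (comp_rank rk (C := C)) b.2,
         nondeg (comp_rank rk (C := C)) (restrict th b).2 &
         fiber_list (comp_graph G C) (restrict th b) (h C)]) ->
  exists s : seq (param T F), [/\ uniq s, size s = (\prod_(C <- cs) h C)%N &
    forall th', (supp_ok G th' /\ phi th' = phi th) /\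
      (forall D, D \in comps G -> D \notin cs -> agree_on D th' th) <-> th' \in s].
Proof.
move=> sth ndth; elim: cs => [_ _ _|C cs IHs /andP[Ccs ucs] csG fib].
  exists [:: th]; split=> //; first by rewrite big_nil.
  move=> th'; rewrite inE; split=> [[[sth' _] agr]|/eqP ->]; last by split=> // D.
  by apply/eqP/(agree_on_all symB sth' sth) => C CG; apply: agr.
have [||s [us ss sP]] := IHs ucs.
- by move=> D Ds; apply: csG; rewrite inE Ds orbT.
- by move=> D Ds; apply: fib; rewrite inE Ds orbT.
have CG : C \in comps G by apply: csG; rewrite mem_head.
have [b [sb ndb ndr [sC [usC ssC sCP]]]] := fib C (mem_head _ _).
have sr := restrict_supp_ok symB rkG CG sth sb.
have ndt t : supp_ok G t -> phi t = phi th -> nondeg rk t.2.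
  move=> st et; apply/(nondeg_phi (supp_unitri rkG st.1)); rewrite et.
  exact/(nondeg_phi (supp_unitri rkG sth.1)).
(* The next two facts recover [x] and [t] from [extend x t]; together they show that the pairs are
   listed without repetition. *)
have xK (x : param (comp_type G C) F) t : x \in sC -> restrict (extend x t) b = x.
  move=> /sCP[sx ex]; apply: (restrict_fiber symB rkG CG t sx _ sr ex).
  exact: (nondeg_fiber symB rkG CG sr sx (esym ex)).
have tK (x : param (comp_type G C) F) t : t \in s -> extend (restrict th b) (extend x t) = t.
  move=> /sP[[st et] agr]; rewrite extend_extend.
  by apply: (extend_agree symB rkG CG b st); apply: agr.
exists [seq extend x t | t <- s, x <- sC]; split.
- apply: allpairs_uniq => // -[t x] [t' x'] /allpairsP[[t0 x0] [/= t0s x0s [-> ->]]].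
  move=> /allpairsP[[t1 x1] [/= t1s x1s [-> ->]]] e.
  by congr (_, _); [rewrite -(tK x0 t0 t0s) e tK | rewrite -(xK x0 t0 x0s) e xK].
- by rewrite size_allpairs ss ssC big_cons mulnC.
move=> th'; split=> [[[sth' eth'] agr] | /allpairsP[[t x] /= [ts xs ->]]].
  have ndth' := ndt _ sth' eth'.
  apply/allpairsP; exists (extend (restrict th b) th', restrict th' b); split=> /=.
  - have er : phi (restrict th b) = phi (restrict th' b).
      by apply: (phi_restrict symB rkG CG).
    apply/sP; split=> [|D DG Ds].
      split; first exact: (extend_supp_ok symB rkG CG).
      by rewrite -eth'; apply: (phi_extend_fiber symB rkG CG sr sth' sb).
    have [->|nDC] := eqVneq D C; first exact: (agree_extend_restrict symB rkG CG).
    have [aL aO] := agree_extend_other symB CG (restrict th b) th' DG nDC.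
    have [aL' aO'] : agree_on D th' th by apply: agr; rewrite // inE negb_or nDC.
    by split=> v w *; [rewrite aL // aL' | rewrite aO // aO'].
  - apply/sCP; split; first exact: (restrict_supp_ok symB rkG CG).
    by apply: (phi_restrict symB rkG CG).
  - by rewrite extend_extend (restrictK symB rkG CG).
have /sP[[st et] agr] := ts; have /sCP[sx ex] := xs.
have ndx := nondeg_fiber symB rkG CG sr sx (esym ex) ndr.
split; [split; first exact: (extend_supp_ok symB rkG CG) |].
  have ert : phi (restrict th b) = phi (restrict t b) by apply: (phi_restrict symB rkG CG).
  rewrite -et; apply: (phi_extend_fiber symB rkG CG sx st sb ndx (ndt t st et)).
  by rewrite ex.
move=> D DG; rewrite inE negb_or => /andP[nDC Ds].
have [aL aO] := agree_extend_other symB CG x t DG nDC.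
have [aL' aO'] := agr D DG Ds.
by split=> v w *; [rewrite aL // aL' | rewrite aO // aO'].
Qed.

End Counting.

Lemma gen_h_to_one_comps (Cf : numClosedFieldType) (T : finType) (G : mgraph T)
    (rk : T -> nat) (h : {set T} -> nat) : symmetric (bid G) -> ranked G rk ->
  (forall C, C \in comps G -> gen_h_to_one Cf (comp_graph G C) (h C)) ->
  gen_h_to_one Cf G (\prod_(C in comps G) h C)%N.
Proof.
move=> symB rkG hC; pose Th := @supp_ok T Cf G.
have segTh : segment_closed Th := supp_ok_segment rkG.
have gC C : C \in enum (comps G) -> generic Th (fun th _ =>
    exists b : param (comp_type G C) Cf,
     [/\ supp_ok (comp_graph G C) b, nondeg (comp_rank rk (C := C)) b.2,
         nondeg (comp_rank rk (C := C)) (restrict th b).2 &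
         fiber_list (comp_graph G C) (restrict th b) (h C)]).
  rewrite mem_enum => CG; have /exists_proper_alg1 gh := hC C CG.
  have rkC := ranked_comp symB rkG CG.
  have gnd := generic_nondeg Cf rkC.
  have inhC : supp_ok (comp_graph G C) (0, idm _ Cf) := supp_ok_id Cf rkC.
  (* Surjectivity of the restriction is witnessed by extending [b] over the pair with zero [Lambda]
     and identity [Omega]. *)
  have [b [sb [ndb _] gG]] := generic_splice
    (fun x b sx sb => restrict_supp_ok symB rkG CG (th := x) (b := b) sx sb)
    (fun b sb => ex_intro2 _ _ (extend b (0, idm T Cf))
       (extend_supp_ok symB rkG CG sb (supp_ok_id Cf rkG))
       (extendK symB rkG CG _ sb))
    (generic_and (supp_ok_segment rkC) gnd gh).
  by apply: generic_sub gG => th _ _ _ [ndr fl]; exists b.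
have inh : exists th, Th th by exists (0, idm T Cf); apply: supp_ok_id rkG.
apply/exists_proper_alg1.
have := generic_and segTh (generic_nondeg Cf rkG) (generic_all segTh inh gC).
apply: generic_sub => th _ sth _ [ndth fib].
have [|s [us ss sP]] := fiber_list_comps symB rkG sth ndth (enum_uniq _) _ fib.
  by move=> C; rewrite mem_enum.
exists s; split=> //; first by rewrite ss big_enum.
move=> th'; rewrite -sP; split=> [Hth' | []//]; split=> // D DG.
by rewrite mem_enum DG.
Qed.

Theorem mainTheorem11 (R : rcfType) (Cf : numClosedFieldType) (m : nat)
    (G : mgraph 'I_m) :
  mixed_graph G -> acyclic G ->
  (rat_ident R G <-> (forall C, C \in comps G -> rat_ident R (comp_graph G C))) /\
  (gen_ident R G <-> (forall C, C \in comps G -> gen_ident R (comp_graph G C))) /\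
  (gen_inf R G <-> (exists2 C, C \in comps G & gen_inf R (comp_graph G C))) /\
  (forall h : {set 'I_m} -> nat,
     (forall C, C \in comps G -> gen_h_to_one Cf (comp_graph G C) (h C)) ->
     gen_h_to_one Cf G (\prod_(C in comps G) h C)%N).
Proof.
move=> [_ [_ symB]] /acyclic_ranked rkG.
split; first exact (rat_ident_comps R symB rkG).
split; first exact (gen_ident_comps R symB rkG).
split; first exact (gen_inf_comps R symB rkG).
by move=> h; apply: (gen_h_to_one_comps symB rkG).
Qed.
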